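(* Let $t\ge 1$ be an integer, let $u=x_{i_1}x_{i_2}\cdots x_{i_d}\in S=K[x_1,\dots,x_n]$ (with $i_1<\cdots<i_d$) be a $t$-spread monomial, and suppose that $i_d=n$. Then the $t$-spread principal Borel ideal $I=B_t(u)$ is sequentially Cohen–Macaulay.
   Context: $K$ is a field, $S=K[x_1,\dots,x_n]$. For a monomial $w$, $\operatorname{supp}(w)=\{j: x_j\mid w\}$; for a monomial ideal $I$, $G(I)$ denotes its unique minimal set of monomial generators. An ideal $I$ is called sequentially Cohen–Macaulay if $S/I$ is a sequentially Cohen–Macaulay $S$-module. For an integer $t\ge 1$, a monomial $x_{i_1}\cdots x_{i_d}\in S$ with $i_1\le\cdots\le i_d$ is called $t$-spread if $i_j-i_{j-1}\ge t$ for $2\le j\le d$. A $t$-spread monomial ideal is an ideal generated by $t$-spread monomials. A $t$-spread monomial ideal $I$ is $t$-spread strongly stable if for all $w\in G(I)$, $j\in\operatorname{supp}(w)$ and $i<j$ such that $x_i(w/x_j)$ is $t$-spread, one has $x_i(w/x_j)\in I$. For a $t$-spread monomial $u=x_{i_1}\cdots x_{i_d}$, $B_t(u)$ denotes the smallest $t$-spread strongly stable ideal containing $u$ (the $t$-spread principal Borel ideal of $u$). Explicitly, $G(B_t(u))$ consists of the monomials $x_{j_1}\cdots x_{j_d}$ with $j_k\le i_k$ for $1\le k\le d$ and $j_k-j_{k-1}\ge t$ for $2\le k\le d$. *)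

(* Defs.v *)
From HB Require Import structures.
From mathcomp Require Import all_boot all_order all_algebra.
From mathcomp Require Export mpoly.

Set Implicit Arguments.
Unset Strict Implicit.
Unset Printing Implicit Defensive.

Import GRing.Theory.
Local Open Scope ring_scope.

(* Ideals are Prop-valued predicates, since the Krull dimension ranges over   *)
(* arbitrary prime ideals, not only over decidable ones.                      *)
(* Every module below is a subquotient J / I of the ring R, for ideals        *)
(* I and J with I included in J: the submodules of R / I are the J / I, and   *)
(* (J2 / I) / (J1 / I) = J2 / J1. The module is written as the pair I, J.     *)

Section CommutativeAlgebra.
Variable R : comNzRingType.
Implicit Types (I J P : R -> Prop) (fs : seq R).

Definition is_ideal I :=
  [/\ I 0, forall f g, I f -> I g -> I (f + g) & forall f g, I g -> I (f * g)].

Definition ideal_gen (A : R -> Prop) (f : R) :=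
  forall I, is_ideal I -> (forall g, A g -> I g) -> I f.

Definition is_prime P :=
  [/\ is_ideal P, ~ P 1 & forall f g, P (f * g) -> P f \/ P g].

(* Ann_R (J / I) *)
Definition annihilator I J (f : R) := forall g, J g -> I (f * g).

Definition prime_chain (A : R -> Prop) (k : nat) (Q : nat -> R -> Prop) :=
  [/\ forall i, (i <= k)%N -> is_prime (Q i),
      forall i, (i <= k)%N -> forall f, A f -> Q i f
    & forall i, (i < k)%N ->
        (forall f, Q i f -> Q i.+1 f) /\ (exists2 f, Q i.+1 f & ~ Q i f)].

(* dim (J / I) = dim (R / Ann_R (J / I)) = d; no d for the zero module *)
Definition has_dim I J (d : nat) :=
  (exists Q, prime_chain (annihilator I J) d Q) /\
  (forall k Q, prime_chain (annihilator I J) k Q -> (k <= d)%N).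

(* The ideal I + (fs) J, so that M / (fs) M = J / (I + (fs) J) for M = J / I. *)
Definition add_mul I fs J : R -> Prop :=
  ideal_gen (fun p => I p \/ exists f g, [/\ f \in fs, J g & p = f * g]).

Definition regular_seq I J fs :=
  (forall k, (k < size fs)%N -> forall g, J g ->
     add_mul I (take k fs) J (fs`_k * g) -> add_mul I (take k fs) J g) /\
  (exists2 g, J g & ~ add_mul I fs J g).

(* depth of J / I with respect to the ideal a *)
Definition has_depth (a : R -> Prop) I J (d : nat) :=
  (exists fs, [/\ forall f, f \in fs -> a f, regular_seq I J fs & size fs = d])
  /\ (forall fs, (forall f, f \in fs -> a f) -> regular_seq I J fs ->
        (size fs <= d)%N).

End CommutativeAlgebra.

Section Graded.
Variables (K : fieldType) (n : nat).
Local Notation S := {mpoly K[n]}.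
Implicit Types (I J : S -> Prop).

Definition graded_ideal I :=
  is_ideal I /\ forall p d, I p -> I (pihomog mdeg d p).

Definition max_graded_ideal : S -> Prop :=
  ideal_gen (fun p => exists i : 'I_n, p = 'X_i).

(* J / I is a (nonzero) Cohen-Macaulay graded module of dimension d. *)
Definition CohenMacaulay_of_dim I J (d : nat) :=
  has_dim I J d /\ has_depth max_graded_ideal I J d.

(* J / I has a finite filtration by graded submodules F i / I with            *)
(* Cohen-Macaulay factors F i.+1 / F i of strictly increasing dimensions.     *)
Definition sequentially_CohenMacaulay I J :=
  exists (r : nat) (F : nat -> S -> Prop) (dimF : nat -> nat),
  [/\ (forall f, F 0%N f <-> I f) /\ (forall f, F r f <-> J f),
      forall i, (i <= r)%N -> graded_ideal (F i),
      forall i, (i < r)%N -> forall f, F i f -> F i.+1 f,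
      forall i, (i < r)%N -> CohenMacaulay_of_dim (F i) (F i.+1) (dimF i)
    & forall i, (i.+1 < r)%N -> (dimF i < dimF i.+1)%N].

Definition sequentially_CohenMacaulay_ideal I :=
  sequentially_CohenMacaulay I (fun=> True).

End Graded.

(* The variables x_1, ..., x_n are 'X_i with i : 'I_n, so indices are shifted *)
(* by one.                                                                    *)
Section Spread.
Variables (K : fieldType) (n : nat).
Local Notation S := {mpoly K[n]}.
Implicit Types (I : S -> Prop) (G : 'X_{1..n} -> Prop) (w : 'X_{1..n}).

(* x_{i_1} ... x_{i_d} for s = [:: i_1; ...; i_d] *)
Definition mon_of_seq (s : seq 'I_n) : 'X_{1..n} := (\sum_(i <- s) U_(i))%MM.

Definition t_spread (t : nat) w :=
  exists2 s : seq 'I_n,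
    sorted (fun i j : 'I_n => (i + t <= j)%N) s & w = mon_of_seq s.

Definition mon_ideal G : S -> Prop :=
  ideal_gen (fun p => exists2 w, G w & p = 'X_[w]).

Definition mon_generators I G := forall f, I f <-> mon_ideal G f.

(* G = G(I) *)
Definition min_mon_generators I G :=
  mon_generators I G /\
  forall G', (forall w, G' w -> G w) -> mon_generators I G' ->
    forall w, G w -> G' w.

Definition t_spread_ideal (t : nat) I :=
  exists2 G, forall w, G w -> t_spread t w & mon_generators I G.

Definition t_spread_strongly_stable (t : nat) I :=
  t_spread_ideal t I /\
  exists2 G, min_mon_generators I G &
    forall w (i j : 'I_n), G w -> (0 < w j)%N -> (i < j)%N ->
      t_spread t (w - U_(j) + U_(i))%MM -> I 'X_[(w - U_(j) + U_(i))%MM].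

(* I = B_t(u) *)
Definition is_t_spread_principal_Borel (t : nat) (u : 'X_{1..n}) I :=
  [/\ t_spread_strongly_stable t I, I 'X_[u]
    & forall J, t_spread_strongly_stable t J -> J 'X_[u] ->
        forall f, I f -> J f].

End Spread.

(* Main.v *)
(* Let I_m be the t-spread principal Borel ideal of x_{i_1} ... x_{i_m}; these *)
(* ideals form a chain from I = I_d up to I_0 = S. Ordering the generators     *)
(* f = x_{j_1} ... x_{j_m} of I_m by the sum of their indices                  *)
(* refines I_{m+1} in I_m to a filtration with factors S / P_Z, where P_Z is   *)
(* generated by the variables outside Z, the union of the blocks               *)
(* [j_k, j_k + t) and of (i_{m+1}, n]. All these Z have                        *)
(* n - i_{m+1} + m t elements, a number that weakly increases as m decreases.  *)
(* A quotient filtered by factors S / P_Z with #|Z| = d is Cohen-Macaulay of   *)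
(* dimension d: the elementary symmetric polynomials e_d, ..., e_1 are a       *)
(* regular sequence on each factor, hence on the quotient, over any field;     *)
(* conversely any r > d polynomials satisfy an algebraic relation modulo the   *)
(* annihilator, whose lexicographically smallest monomial contradicts the      *)
(* existence of a prime chain or of a regular sequence of length r. It remains *)
(* to merge consecutive factors of equal dimension.                            *)

Require Import Defs.
From mathcomp Require Import all_boot all_order all_algebra.
From mathcomp Require Import zify.
From Stdlib Require Import Relation_Operators.

Set Implicit Arguments.
Unset Strict Implicit.
Unset Printing Implicit Defensive.

Import GRing.Theory.
Local Open Scope ring_scope.

(** The generators of I_m, adjoined to I_(m+1) by increasing index sum, have linear quotients: the
    colon ideal before each generator x_s is P_Z ([borel_colon]). A variable x_a outside Z turns s
    into a generator of I_(m+1), or into one of I_m with smaller sum ([admissible_exchange]).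
    Conversely, a t-spread sequence has at most one index in each block of s, so inside the blocks
    it is neither longer than s nor, at equal length, of smaller sum ([blocks_dominate]).

    All Z have the same size d, so the single sequence e_d, ..., e_1 is regular on every factor S /
    P_Z ([weakly_regular_esyms]), hence on I_m / I_(m+1) ([weakly_regular_ext]). Algebraic
    dependence bounds dimension and depth from above ([clean_dependent], [strip_relation]), which
    yields [clean_CohenMacaulay]. Since consecutive indices of u differ by at least t, the
    dimensions increase weakly along the chain; [sequentially_CohenMacaulay_clean] makes them strict
    by merging. *)

(** * Ideals, weakly regular sequences and algebraic relations *)

Section Ideals.
Variable R : comNzRingType.
Implicit Types (I J A B : R -> Prop) (fs : seq R).

Lemma ideal0 I : is_ideal I -> I 0.
Proof. by case. Qed.

Lemma idealD I f g : is_ideal I -> I f -> I g -> I (f + g).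
Proof. by case=> _ + _; apply. Qed.

Lemma idealM I f g : is_ideal I -> I g -> I (f * g).
Proof. by case=> _ _; apply. Qed.

Lemma idealMr I f g : is_ideal I -> I g -> I (g * f).
Proof. by rewrite mulrC; apply: idealM. Qed.

Lemma idealB I f g : is_ideal I -> I f -> I g -> I (f - g).
Proof.
by move=> idI If Ig; apply: idealD => //; rewrite -mulN1r; apply: idealM.
Qed.

Lemma idealDr I f g : is_ideal I -> I g -> I (f + g) -> I f.
Proof. by move=> idI Ig Ifg; rewrite -(addrK g f); apply: idealB. Qed.

Lemma idealBr I f g : is_ideal I -> I g -> I (f - g) -> I f.
Proof. by move=> idI Ig Ifg; rewrite -(subrK g f); apply: idealD. Qed.

Lemma ideal_sum I (T : eqType) (r : seq T) (F : T -> R) :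
  is_ideal I -> (forall i, i \in r -> I (F i)) -> I (\sum_(i <- r) F i).
Proof.
move=> idI IF; rewrite big_seq; elim/big_ind: _ => //; first exact: ideal0.
by move=> f g; apply: idealD.
Qed.

Lemma ideal_gen_ideal (A : R -> Prop) : is_ideal (ideal_gen A).
Proof.
split=> [I idI _ | f g Af Ag I idI AI | f g Ag I idI AI].
- exact: ideal0.
- by apply: idealD => //; [apply: Af | apply: Ag].
- by apply: idealM => //; apply: Ag.
Qed.

Lemma ideal_gen_sub A f : A f -> ideal_gen A f.
Proof. by move=> Af I _; apply. Qed.

(** The ideal I + f J, so that M / f M = J / (I + f J) for M = J / I; a single g suffices since J is
    an ideal. *)
Definition add_prod I f J (p : R) := exists2 g, J g & I (p - f * g).

Lemma add_prod_ideal I f J :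
  is_ideal I -> is_ideal J -> is_ideal (add_prod I f J).
Proof.
move=> idI idJ; split=> [|p q [g Jg Ip] [h Jh Iq] | p q [g Jg Iq]].
- by exists 0; [apply: ideal0 | rewrite mulr0 subrr; apply: ideal0].
- exists (g + h); first exact: idealD.
  by rewrite mulrDr opprD addrACA; apply: idealD.
- exists (p * g); first exact: idealM.
  by rewrite mulrCA -mulrBr; apply: idealM.
Qed.

Lemma add_prodl I f J p : is_ideal J -> I p -> add_prod I f J p.
Proof. by move=> idJ Ip; exists 0; [apply: ideal0 | rewrite mulr0 subr0]. Qed.

Lemma add_prodr I f J g : is_ideal I -> J g -> add_prod I f J (f * g).
Proof. by move=> idI Jg; exists g; last by rewrite subrr; apply: ideal0. Qed.

Lemma add_prod_min I f J L : is_ideal L -> (forall p, I p -> L p) ->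
  (forall g, J g -> L (f * g)) -> forall p, add_prod I f J p -> L p.
Proof.
by move=> idL IL JL p [g Jg /IL]; apply: idealBr => //; apply: JL.
Qed.

Lemma add_mul_ideal I fs J : is_ideal (add_mul I fs J).
Proof. exact: ideal_gen_ideal. Qed.

Lemma add_mul_min I fs J L : is_ideal L -> (forall p, I p -> L p) ->
  (forall f g, f \in fs -> J g -> L (f * g)) ->
  forall p, add_mul I fs J p -> L p.
Proof.
by move=> idL IL JL p; apply=> // q [/IL // | [f [g [fs_f Jg ->]]]]; apply: JL.
Qed.

Lemma add_mull I fs J p : I p -> add_mul I fs J p.
Proof. by move=> Ip; apply: ideal_gen_sub; left. Qed.

Lemma add_mulr I fs J f g : f \in fs -> J g -> add_mul I fs J (f * g).
Proof. by move=> fs_f Jg; apply: ideal_gen_sub; right; exists f, g. Qed.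

Lemma add_mul_nil I J p : is_ideal I -> add_mul I [::] J p <-> I p.
Proof. by move=> idI; split; [apply: add_mul_min | apply: add_mull]. Qed.

Lemma add_mul_cons I f fs J p : is_ideal I -> is_ideal J ->
  add_mul I (f :: fs) J p <-> add_mul (add_prod I f J) fs J p.
Proof.
move=> idI idJ; split; apply: add_mul_min; try exact: add_mul_ideal.
- by move=> q Iq; apply: add_mull; apply: add_prodl.
- move=> h g; rewrite inE => /predU1P[-> | fs_h] Jg.
    by apply: add_mull; apply: add_prodr.
  exact: add_mulr.
- apply: add_prod_min; first exact: add_mul_ideal.
    by move=> q; apply: add_mull.
  by move=> g; apply: add_mulr; apply: mem_head.
- by move=> h g fs_h; apply: add_mulr; rewrite inE fs_h orbT.
Qed.

Lemma add_mul_sub I fs fs' J p : {subset fs <= fs'} ->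
  add_mul I fs J p -> add_mul I fs' J p.
Proof.
move=> sfs; apply: add_mul_min; first exact: add_mul_ideal.
  by move=> q; apply: add_mull.
by move=> f g /sfs; apply: add_mulr.
Qed.

(** Regular sequences without the condition that the last quotient be nonzero, in a form suited to
    induction: after f, pass from M to M / f M. *)
Fixpoint weakly_regular I J fs : Prop :=
  if fs is f :: fs' then
    (forall g, J g -> I (f * g) -> I g) /\
    weakly_regular (add_prod I f J) J fs'
  else True.

Lemma weakly_regularP I J fs : is_ideal I -> is_ideal J ->
  weakly_regular I J fs -> forall k, (k < size fs)%N -> forall g, J g ->
  add_mul I (take k fs) J (fs`_k * g) -> add_mul I (take k fs) J g.
Proof.
move=> + idJ; elim: fs I => [|f fs IH] I idI //= [reg_f reg_fs] [|k] lt_k g Jg.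
  by rewrite take0 /= !add_mul_nil //; apply: reg_f.
rewrite /= !add_mul_cons //; apply: IH => //; exact: add_prod_ideal.
Qed.

(* Multiplication by h induces an isomorphism from A / I onto B / J. *)
Lemma weakly_regular_iso h I A J B fs :
  is_ideal I -> is_ideal A -> is_ideal J -> is_ideal B ->
  (forall x, A x -> B (h * x)) ->
  (forall y, B y -> exists2 x, A x & J (y - h * x)) ->
  (forall x, A x -> (J (h * x) <-> I x)) ->
  weakly_regular I A fs -> weakly_regular J B fs.
Proof.
move=> + idA + idB hAB hsurj.
elim: fs I J hsurj => //= f fs IH I J hsurj idI idJ hIJ [reg_f reg_fs]; split.
  move=> y By Jfy; have [x Ax Jyx] := hsurj y By.
  apply: (idealBr idJ _ Jyx); apply/hIJ => //.
  apply: (reg_f x Ax); apply/(hIJ (f * x)); first exact: idealM.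
  have -> : h * (f * x) = f * y - f * (y - h * x).
    by rewrite mulrBr opprB addrC subrK mulrCA.
  by apply: idealB => //; apply: idealM.
apply: IH reg_fs; try exact: add_prod_ideal.
  move=> y By; have [x Ax Jyx] := hsurj y By.
  by exists x => //; apply: add_prodl.
move=> x Ax; split.
  case=> y By; have [x' Ax' Jyx'] := hsurj y By => Jxy.
  exists x' => //; apply/hIJ; first by apply: idealB => //; apply: idealM.
  have -> : h * (x - f * x') = h * x - f * y + f * (y - h * x').
    by rewrite !mulrBr addrA subrK mulrCA.
  by apply: idealD => //; apply: idealM.
case=> x' Ax' Ixx'; exists (h * x'); first exact: hAB.
rewrite mulrCA -mulrBr; apply/hIJ => //.
by apply: idealB => //; apply: idealM.
Qed.

(** In an exact sequence 0 -> A -> B -> C -> 0, an f regular on A and C is regular on B, and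
    regularity on C keeps A / f A -> B / f B injective, so the argument repeats on the quotients. *)
Lemma weakly_regular_ext I J1 J fs :
  is_ideal I -> is_ideal J1 -> is_ideal J ->
  (forall x, I x -> J1 x) -> (forall x, J1 x -> J x) ->
  weakly_regular I J1 fs -> weakly_regular J1 J fs -> weakly_regular I J fs.
Proof.
move=> + + idJ.
elim: fs I J1 => //= f fs IH I J1 idI id1 sI1 s1J [regI regIs] [reg1 reg1s].
split.
  move=> g Jg Ifg; apply: regI => //; apply: reg1 => //; exact: sI1.
apply: IH reg1s; try exact: add_prod_ideal.
- by move=> x [g Jg Ixg]; exists g => //; apply: sI1.
- apply: add_prod_min => // g; exact: idealM.
(* As f is regular on J / J1, the ideal J1 meets I + f J only in I + f J1; hence J1 / (I + f J1) is
   isomorphic to (J1 + f J) / (I + f J). *)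
apply: (@weakly_regular_iso 1) regIs; try by do ?exact: add_prod_ideal.
- by move=> x x1; rewrite mul1r; apply: add_prodl.
- move=> y [g Jg ygJ]; exists (y - f * g) => //.
  rewrite mul1r subKr; exact: add_prodr.
move=> x x1; rewrite mul1r; split=> -[g Jg Ixg]; exists g => //.
  apply: reg1 => //; rewrite -[_ * _](subKr x); apply: idealB => //.
  exact: sI1.
exact: s1J.
Qed.

Lemma weakly_regular_triv I J fs : is_ideal I -> is_ideal J ->
  (forall x, J x -> I x) -> weakly_regular I J fs.
Proof.
move=> + idJ; elim: fs I => //= f fs IH I idI JI; split.
  by move=> g /JI.
by apply: IH => [|x /JI Ix]; [apply: add_prod_ideal | apply: add_prodl].
Qed.

Fixpoint monom_eval fs (a : seq nat) : R :=
  match fs, a with f :: fs', k :: a' => f ^+ k * monom_eval fs' a' | _, _ => 1 end.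

Lemma monom_evalE fs a : size a = size fs ->
  monom_eval fs a = \prod_(i < size fs) fs`_i ^+ nth 0%N a i.
Proof.
elim: fs a => [|f fs IH] [|k a] //=; first by rewrite big_ord0.
by case=> szE; rewrite big_ord_recl IH.
Qed.

(* Terms of minimal exponent in the first variable are isolated by dividing   *)
(* by a power of f_0 (a nonzerodivisor) and then killing f_0; iterating       *)
(* leaves the lexicographically smallest term only.                           *)
Lemma strip_relation A fs (N : nat -> R -> Prop) (T : seq (seq nat * R)) g :
  is_ideal A -> (forall i, is_ideal (N i)) ->
  (forall i, (i < size fs)%N -> forall x, A x -> N i (fs`_i * x) -> N i x) ->
  (forall i, (i < size fs)%N -> forall x, A x -> N i.+1 (fs`_i * x)) ->
  (forall i, (i < size fs)%N -> forall x, N i x -> N i.+1 x) ->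
  T != [::] -> uniq [seq p.1 | p <- T] ->
  (forall p, p \in T -> size p.1 = size fs /\ exists c, c * p.2 = 1) ->
  A g -> N 0%N ((\sum_(p <- T) p.2 * monom_eval fs p.1) * g) -> N (size fs) g.
Proof.
move=> idA; elim: fs N T => [|f fs IH] N T idN reg kill inc nzT uT unitT Ag.
  (* All exponent lists are empty here, so uniqueness leaves a single term, with a unit
     coefficient. *)
  case: T nzT uT unitT => [//|p [|q T]] _ /=; last first.
    move=> uT unitT; case: (unitT p) => [|/size0nil p0 _]; first exact: mem_head.
    case: (unitT q) => [|/size0nil q0 _]; first by rewrite !inE eqxx orbT.
    by rewrite p0 q0 mem_head in uT.
  move=> _ /(_ p) []; first exact: mem_head.
  move=> _ [c cp1]; rewrite big_seq1 mulr1 => Ng.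
  by rewrite -[g]mul1r -cp1 -mulrA; apply: idealM.
have exT : exists k, has (fun p => head 0%N p.1 == k) T.
  by case: T nzT {uT unitT} => // p T _; exists (head 0%N p.1); rewrite /= eqxx.
case: (ex_minnP exT) => m has_m min_m => N0g.
have le_m p : p \in T -> (m <= head 0%N p.1)%N.
  by move=> Tp; apply: min_m; apply/hasP; exists p.
(* The relation applied to g, with f ^+ k divided out; the subtraction is exact as long as k is at
   most m. *)
pose F k := (\sum_(p <- T)
  p.2 * (f ^+ (head 0%N p.1 - k) * monom_eval fs (behead p.1))) * g.
have AF k : A (F k) by apply: idealM.
have N0F k : (k <= m)%N -> N 0%N (F k).
  elim: k => [|k IHk] le_km.
    rewrite /F; under eq_big_seq => p Tp.
      have -> : f ^+ (head 0%N p.1 - 0) * monom_eval fs (behead p.1) =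
                monom_eval (f :: fs) p.1.
        by have [] := unitT p Tp; case: (p.1) => //= a s _ _; rewrite subn0.
      over.
    exact: N0g.
  apply: (reg 0%N) => //=.
  suff -> : f * F k.+1 = F k by apply: IHk; apply: ltnW.
  rewrite /F mulrA mulr_sumr; congr (_ * g); apply: eq_big_seq => p Tp.
  rewrite mulrCA; congr (_ * _); rewrite mulrA; congr (_ * _).
  by rewrite -exprS subnS prednK ?subn_gt0 ?(leq_trans le_km) // le_m.
(* The terms of least exponent m in f; the other terms of [F m] are multiples of f, hence lie in
   [N 1]. *)
pose T' := [seq (behead p.1, p.2) | p <- T & head 0%N p.1 == m].
have T'P q : q \in T' -> exists2 p, p \in T & p.1 = m :: q.1 /\ p.2 = q.2.
  case/mapP=> p; rewrite mem_filter => /andP[/eqP hp Tp] ->; exists p => //=.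
  by have [] := unitT p Tp; case: (p.1) hp => //= a s ->.
apply: (IH (fun i => N i.+1) T') => //.
- by move=> i; apply: (reg i.+1).
- by move=> i; apply: (kill i.+1).
- by move=> i; apply: (inc i.+1).
- case/hasP: has_m => p Tp hp; apply/eqP=> T'0.
  suff: (behead p.1, p.2) \in T' by rewrite T'0.
  by apply/mapP; exists p; rewrite // mem_filter hp.
- suff: uniq [seq m :: p.1 | p <- T'].
    by rewrite (map_comp (cons m)) map_inj_uniq // => x y [].
  rewrite -map_comp.
  have -> : [seq ((fun p : seq nat * R => m :: p.1) \o
              (fun p : seq nat * R => (behead p.1, p.2))) p
            | p <- T & head 0%N p.1 == m] =
            [seq p.1 | p <- T & head 0%N p.1 == m].
    apply/eq_in_map=> p; rewrite mem_filter => /andP[/eqP hp Tp] /=.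
    by have [] := unitT p Tp; case: (p.1) hp => //= a s ->.
  by apply: subseq_uniq uT; apply: map_subseq; apply: filter_subseq.
- move=> q /T'P[p Tp [p1 p2]]; have [] := unitT p Tp.
  by rewrite p1 p2 => -[].
have N1F : N 1%N (F m) by apply: (inc 0%N) => //; apply: N0F.
move: N1F; rewrite /F (bigID (fun p => head 0%N p.1 == m)) /= mulrDl.
rewrite (_ : \sum_(p <- T') _ = \sum_(p <- T | head 0%N p.1 == m)
  p.2 * (f ^+ (head 0%N p.1 - m) * monom_eval fs (behead p.1))); last first.
  rewrite big_map big_filter; apply: eq_bigr => p /eqP->.
  by rewrite subnn expr0 mul1r.
apply: idealDr => //; rewrite mulr_suml -big_filter.
apply: ideal_sum => // p; rewrite mem_filter => /andP[hp Tp].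
have lt_m : (m < head 0%N p.1)%N by rewrite ltn_neqAle eq_sym hp le_m.
rewrite -subn_gt0 in lt_m; case: (_ - _)%N lt_m => // k _.
have -> : p.2 * (f ^+ k.+1 * monom_eval fs (behead p.1)) * g =
          f * ((p.2 * f ^+ k * monom_eval fs (behead p.1)) * g).
  by rewrite exprS !mulrA; congr (_ * _ * _); rewrite [p.2 * _]mulrC -!mulrA;
    congr (_ * _); apply: mulrC.
by apply: (kill 0%N) => //; apply: idealM.
Qed.

End Ideals.

(** * Primes generated by variables *)

Section CoordinatePrimes.
Variables (K : fieldType) (n : nat).
Local Notation S := {mpoly K[n]}.
Implicit Types (I J : S -> Prop) (Z : {set 'I_n}) (m : 'X_{1..n}) (p : S).

Lemma ideal_mpoly I p :
  is_ideal I -> (forall m, m \in msupp p -> I 'X_[m]) -> I p.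
Proof.
move=> idI Ip; rewrite (mpolyE p); apply: ideal_sum => // m /Ip Im.
by rewrite -mul_mpolyC; apply: idealM.
Qed.

Lemma max_graded_ideal_ideal : is_ideal (@max_graded_ideal K n).
Proof. exact: ideal_gen_ideal. Qed.

Lemma max_graded_idealP p : max_graded_ideal p <-> p@_0%MM = 0.
Proof.
split.
  move/(_ (fun p => p@_0%MM = 0)); apply.
    split=> [|f g f0 g0 | f g g0]; first exact: mcoeff0.
      by rewrite mcoeffD f0 g0 addr0.
    by rewrite rmorphM /= g0 mulr0.
  by move=> _ [i ->]; rewrite mcoeffX mnm1_eq0.
move=> p0; apply: (ideal_mpoly max_graded_ideal_ideal) => m.
rewrite mcoeff_msupp => pm.
have: m != 0%MM by apply: contraNneq pm => ->; rewrite p0.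
rewrite -mdeg_eq0 mdegE.
rewrite sum_nat_eq0 => /forallPn[i]; rewrite /= -lt0n => mi.
have -> : m = (U_(i) + (m - U_(i)))%MM.
  by apply/mnmP=> j; rewrite mnmDE mnmBE mnm1E; case: eqP => [<-|_];
    rewrite ?add0n ?subn0 ?subnKC.
rewrite mpolyXD; apply: (idealMr _ max_graded_ideal_ideal).
by apply: ideal_gen_sub; exists i.
Qed.

Definition mnm_on Z m := [forall i, (0 < m i)%N ==> (i \in Z)].

Lemma mnm_onP Z m : reflect (forall i, (0 < m i)%N -> i \in Z) (mnm_on Z m).
Proof. exact: 'forall_implyP. Qed.

Lemma mnm_onS Z Z' m : Z \subset Z' -> mnm_on Z m -> mnm_on Z' m.
Proof.
by move=> /subsetP sZ /mnm_onP mZ; apply/mnm_onP => i /mZ /sZ.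
Qed.

(* The ideal generated by the variables outside Z. *)
Definition coord_prime Z p := forall m, mnm_on Z m -> p@_m = 0.

(** Setting the variables outside Z to 0 is a ring morphism into a domain with kernel P_Z; this is
    why P_Z is prime. *)
Definition restr Z p : S := p \mPo [tuple if i \in Z then 'X_i else 0 | i < n].

Lemma restr_mnm Z m : restr Z 'X_[m] = if mnm_on Z m then 'X_[m] else 0.
Proof.
rewrite /restr comp_mpolyX; case: mnm_onP => [mZ | /mnm_onP].
  rewrite mpolyXE_id; apply: eq_bigr => i _; rewrite tnth_mktuple.
  by case: (posnP (m i)) => [->|/mZ->] //; rewrite !expr0.
case/forallPn=> i; rewrite negb_imply => /andP[mi /negPf iZ].
by rewrite (bigD1 i) //= tnth_mktuple iZ expr0n gtn_eqF // mul0r.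
Qed.

Lemma mcoeff_restr Z p m : (restr Z p)@_m = if mnm_on Z m then p@_m else 0.
Proof.
rewrite {1}/restr comp_mpolyEX raddf_sum /=.
under eq_bigr => k _ do rewrite mcoeffZ -/(restr Z _) restr_mnm.
case: ifPn => mZ; last first.
  rewrite big1 // => k _; case: ifPn => kZ; last by rewrite mcoeff0 mulr0.
  rewrite mcoeffX; case: eqP => [km | _]; last by rewrite mulr0.
  by rewrite -km kZ in mZ.
rewrite [in RHS](mpolyE p) raddf_sum /=; apply: eq_bigr => k _.
rewrite mcoeffZ; case: ifPn => // kZ.
rewrite mcoeff0 mcoeffX; case: eqP => [km | //].
by rewrite km mZ in kZ.
Qed.

Lemma coord_primeE Z p : coord_prime Z p <-> restr Z p = 0.
Proof.
split=> [Zp | p0 m mZ].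
  by apply/mpolyP => m; rewrite mcoeff_restr mcoeff0; case: ifP => // /Zp.
by have := mcoeff_restr Z p m; rewrite mZ p0 mcoeff0.
Qed.

Lemma coord_prime_prime Z : is_prime (coord_prime Z).
Proof.
split; first split.
- by apply/coord_primeE; apply: comp_mpoly0.
- move=> f g /coord_primeE f0 /coord_primeE g0; apply/coord_primeE.
  by rewrite /restr comp_mpolyD -!/(restr Z _) f0 g0 addr0.
- move=> f g /coord_primeE g0; apply/coord_primeE.
  by rewrite /restr rmorphM /= -!/(restr Z _) g0 mulr0.
- by move/coord_primeE; rewrite /restr comp_mpoly1 => /eqP; rewrite oner_eq0.
- move=> f g /coord_primeE; rewrite /restr rmorphM /= -!/(restr Z _) => /eqP.
  by rewrite mulf_eq0 => /orP[] /eqP ?; [left | right]; apply/coord_primeE.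
Qed.

Lemma coord_prime_ideal Z : is_ideal (coord_prime Z).
Proof. by case: (coord_prime_prime Z). Qed.

Lemma coord_primeX Z m : coord_prime Z 'X_[m] <-> ~~ mnm_on Z m.
Proof.
split=> [Zm | mZ k kZ].
  by apply/negP => /Zm; rewrite mcoeffX eqxx => /eqP; rewrite oner_eq0.
by rewrite mcoeffX; case: eqP => // mk; rewrite mk kZ in mZ.
Qed.

Lemma mnm_onU Z i : mnm_on Z U_(i) = (i \in Z).
Proof.
apply/mnm_onP/idP => [-> // | iZ j]; first by rewrite mnm1E eqxx.
by rewrite mnm1E; case: eqP => [<-|].
Qed.

Lemma coord_primeXU Z i : coord_prime Z 'X_i <-> i \notin Z.
Proof. by rewrite -mnm_onU; apply: coord_primeX. Qed.

Lemma coord_primeS Z Z' p :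
  Z \subset Z' -> coord_prime Z' p -> coord_prime Z p.
Proof. by move=> sZ Zp m /(mnm_onS sZ) /Zp. Qed.

Lemma coord_primeD1 Z i p :
  coord_prime (Z :\ i) p -> exists a, coord_prime Z (p - a * 'X_i).
Proof.
move=> Zip; suff: ideal_gen (fun q => coord_prime Z q \/ q = 'X_i) p.
  move/(_ (fun q => exists a, coord_prime Z (q - a * 'X_i))); apply; last first.
    move=> q [Zq | ->]; first by exists 0; rewrite mul0r subr0.
    by exists 1; rewrite mul1r subrr; apply: (ideal0 (coord_prime_ideal Z)).
  split; first by exists 0; rewrite mul0r subrr;
    apply: (ideal0 (coord_prime_ideal Z)).
    move=> f g [a Za] [b Zb]; exists (a + b); rewrite mulrDl opprD addrACA.
    exact: (idealD (coord_prime_ideal Z)).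
  move=> f g [a Za]; exists (f * a); rewrite -mulrA -mulrBr.
  exact: (idealM _ (coord_prime_ideal Z)).
have idG := ideal_gen_ideal (fun q => coord_prime Z q \/ q = 'X_i).
apply: (ideal_mpoly idG) => m.
rewrite mcoeff_msupp => pm; case: (posnP (m i)) => [mi0 | mi].
  apply: ideal_gen_sub; left; apply/coord_primeX; apply: contra pm => mZ.
  rewrite Zip //; apply/mnm_onP => j mj; rewrite !inE (mnm_onP _ _ mZ) // andbT.
  by apply: contraTneq mj => ->; rewrite mi0.
have -> : m = (U_(i) + (m - U_(i)))%MM.
  by apply/mnmP=> j; rewrite mnmDE mnmBE mnm1E; case: eqP => [<-|_];
    rewrite ?add0n ?subn0 ?subnKC.
by rewrite mpolyXD; apply: (idealMr _ idG); apply: ideal_gen_sub; right.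
Qed.

End CoordinatePrimes.

Lemma weakly_regular_eq (R : comNzRingType) (I J A : R -> Prop) (fs : seq R) :
  is_ideal I -> is_ideal J -> is_ideal A -> (forall x, I x <-> J x) ->
  weakly_regular I A fs -> weakly_regular J A fs.
Proof.
move=> idI idJ idA eqIJ; apply: (@weakly_regular_iso _ 1) => //.
- by move=> x; rewrite mul1r.
- by move=> y Ay; exists y => //; rewrite mul1r subrr; apply: ideal0.
- by move=> x _; rewrite mul1r; apply: iff_sym.
Qed.

Lemma ideal_full (R : comNzRingType) : is_ideal (fun _ : R => True).
Proof. by []. Qed.

(** * Elementary symmetric polynomials as a regular sequence *)

Section SymmetricSequence.
Variables (K : fieldType) (n : nat).
Local Notation S := {mpoly K[n]}.
Implicit Types (I J : S -> Prop) (Z : {set 'I_n}) (m : 'X_{1..n}) (p : S).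

(** Degrees decrease: on S / P_Z with #|Z| = k, e_k is a single product, and killing it leads to
    primes with k - 1 free variables. The sequence does not depend on Z. *)
Fixpoint esyms (k : nat) : seq S :=
  if k is k'.+1 then mesym n K k :: esyms k' else [::].

Lemma size_esyms k : size (esyms k) = k.
Proof. by elim: k => //= k ->. Qed.

Lemma esyms_max k p : p \in esyms k -> max_graded_ideal p.
Proof.
elim: k => //= k IH; rewrite inE => /predU1P[-> | /IH //].
apply/max_graded_idealP; rewrite mcoeff_mesym /mechar mdeg0.
by [].
Qed.

(** Every other squarefree monomial of degree #|Z| involves a variable outside Z. *)
Lemma mesym_coord_prime Z :
  coord_prime Z (mesym n K #|Z| - \prod_(i <- enum Z) 'X_i).
Proof.
rewrite mesymE (bigD1 Z) //= addrC.
have -> : 'X_[mesym1 Z] = \prod_(i <- enum Z) 'X_i :> S.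
  rewrite mpolyXE_id big_enum [RHS]big_mkcond /=; apply: eq_bigr => i _.
  by rewrite mnmE; case: (i \in Z).
rewrite addrK -big_filter; apply: (ideal_sum (coord_prime_ideal K Z)) => h.
rewrite mem_filter => /andP[/andP[/eqP hZ nhZ] _].
apply/coord_primeX; apply: contra nhZ => /mnm_onP onZ.
rewrite eqEcard hZ leqnn andbT; apply/subsetP => i hi.
by apply: onZ; rewrite mnmE hi.
Qed.

Lemma coord_prime_prodX Z (s : seq 'I_n) :
  {subset s <= Z} -> ~ @coord_prime K n Z (\prod_(i <- s) 'X_i).
Proof.
have [_ one_notin PZ] := coord_prime_prime K Z.
elim: s => [|i s IH] sZ; first by rewrite big_nil.
rewrite big_cons => /PZ[/coord_primeXU|].
  by rewrite sZ ?mem_head.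
by apply: IH => j sj; apply: sZ; rewrite inE sj orbT.
Qed.

(* S / (P_Z + (e_k)), where e_k is the product of the variables in Z modulo   *)
(* P_Z, has a filtration with factors S / P_(Z - i), i in Z.                  *)
Lemma weakly_regular_esyms k Z : #|Z| = k ->
  weakly_regular (@coord_prime K n Z) (fun=> True) (esyms k).
Proof.
have idT := @ideal_full S.
elim: k Z => //= k IH Z cZ; have idZ := coord_prime_ideal K Z.
have [_ _ PZ] := coord_prime_prime K Z.
have eZ := @mesym_coord_prime Z; rewrite cZ in eZ.
split=> [g _ /PZ[eZ0 | //]|].
  exfalso; apply: (@coord_prime_prodX Z (enum Z)).
    by move=> i; rewrite mem_enum.
  by rewrite -[X in coord_prime _ X](subKr (mesym n K k.+1)); apply: (idealB idZ).
(* Replaces e_(k+1) by the product over Z, which is then built up one variable at a time. *)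
suff H (s : seq 'I_n) : {subset s <= Z} ->
    weakly_regular (add_prod (@coord_prime K n Z) (\prod_(i <- s) 'X_i) (fun=> True))
      (fun=> True) (esyms k).
  apply: weakly_regular_eq (H (enum Z) _) => //; try exact: add_prod_ideal.
    move=> x; split=> -[g _ Zx]; exists g => //.
      have := idealB idZ Zx (idealMr g idZ eZ).
      by rewrite mulrBl opprB addrA subrK.
    have := idealD idZ Zx (idealMr g idZ eZ).
    by rewrite mulrBl addrA subrK.
  by move=> i; rewrite mem_enum.
elim: s => [|i s IHs] sZ.
  rewrite big_nil; apply: weakly_regular_triv => //; first exact: add_prod_ideal.
  by move=> x _; exists x => //; rewrite mul1r subrr; apply: ideal0.
have {}IHs : weakly_regular
    (add_prod (@coord_prime K n Z) (\prod_(i <- s) 'X_i) (fun=> True))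
    (fun=> True) (esyms k).
  by apply: IHs => j sj; apply: sZ; rewrite inE sj orbT.
apply: weakly_regular_ext IHs => //; try exact: add_prod_ideal.
  by move=> x [g _ Zx]; exists ('X_i * g) => //;
    rewrite mulrCA mulrA -(big_cons _ _ i s xpredT).
have iZ : i \in Z by apply/sZ/mem_head.
have cZi : #|Z :\ i| = k by move: cZ; rewrite (cardsD1 i) iZ => -[].
(* Multiplication by the product over s identifies S / P_(Z - i) with the submodule that this
   product generates. *)
apply: (@weakly_regular_iso _ (\prod_(j <- s) 'X_j) _ _ _ _ _ _ _ _ _ _ _ _
    (IH _ cZi));
  rewrite ?big_cons => //;
    try by do ?[apply: add_prod_ideal | apply: coord_prime_ideal].
- by move=> x _; apply: add_prodr.
- by move=> y [g _ Zy]; exists g => //; apply: add_prodl.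
move=> x _; split.
  case=> g _; rewrite -mulrA mulrCA -mulrBr => /PZ[|Zx].
    by case/coord_prime_prodX=> j sj; apply: sZ; rewrite inE sj orbT.
  apply: (idealBr (coord_prime_ideal K (Z :\ i)) _ (coord_primeS (subsetDl Z [set i]) Zx)).
  apply: (idealMr _ (coord_prime_ideal K (Z :\ i))).
  by apply/coord_primeXU; rewrite !inE eqxx.
case/coord_primeD1=> a Zx; exists a => //.
by rewrite -mulrA mulrCA -mulrBr ['X_i * a]mulrC; apply: (idealM _ idZ).
Qed.

End SymmetricSequence.

(** * Algebraic dependence modulo a coordinate prime *)

Section AlgebraicDependence.
Variables (K : fieldType) (n : nat).
Local Notation S := {mpoly K[n]}.
Implicit Types (I J : S -> Prop) (Z : {set 'I_n}) (m : 'X_{1..n}) (p : S).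

Lemma msizeM_bound p q a b : (msize p <= a.+1)%N -> (msize q <= b.+1)%N ->
  (msize (p * q) <= (a + b).+1)%N.
Proof.
have [->|nzp] := eqVneq p 0; first by rewrite mul0r msize0.
have [->|nzq] := eqVneq q 0; first by rewrite mulr0 msize0.
move=> szp szq; rewrite msizeM // -subn1 leq_subLR add1n -addSn -addnS.
exact: leq_add.
Qed.

Lemma msize_exp_bound p B k :
  (msize p <= B.+1)%N -> (msize (p ^+ k) <= (k * B).+1)%N.
Proof.
move=> szp; elim: k => [|k IH]; first by rewrite expr0 msize1.
by rewrite exprS mulSn msizeM_bound.
Qed.

Lemma msize_prod_bound (T : Type) (s : seq T) (F : T -> S) B :
  (forall i, msize (F i) <= B.+1)%N ->
  (msize (\prod_(i <- s) F i) <= (size s * B).+1)%N.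
Proof.
move=> szF; elim: s => [|i s IH]; first by rewrite big_nil msize1.
by rewrite big_cons /= mulSn msizeM_bound.
Qed.

(* The number N^r of monomials of multidegree < N in r variables exceeds, for *)
(* N large, the number D^(#|Z|) of monomials on Z that can occur in their     *)
(* values at h.                                                               *)
Lemma coord_prime_dependent Z r (h : r.-tuple S) : (#|Z| < r)%N ->
  exists2 G : {mpoly K[r]}, G != 0 & coord_prime Z (G \mPo h).
Proof.
move=> ltZr.
pose B := (\max_(i < r) msize (tnth h i))%N.
have szh i : (msize (tnth h i) <= B.+1)%N.
  by apply: leqW; apply: (leq_bigmax i).
(* D is at most (rB + 1) N and N exceeds (rB + 1)^#|Z|, so D^#|Z| < N^(#|Z| + 1) <= N^r. *)
pose N := ((r * B).+1 ^ #|Z|).+1.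
pose D := (r * (N * B)).+1.
pose E := {ffun 'I_r -> 'I_N}; pose C := {ffun {i | i \in Z} -> 'I_D}.
have ltCE : (#|C| < #|E|)%N.
  rewrite !card_ffun !card_ord card_sig.
  have -> : #|[pred x | x \in Z]| = #|Z| by apply: eq_card.
  apply: (@leq_trans (N ^ #|Z|.+1)); last exact: leq_pexp2l.
  rewrite expnS.
  apply: (@leq_ltn_trans (((r * B).+1 * N) ^ #|Z|)).
    case: (#|Z|) => // k; rewrite leq_exp2r // /D mulSn [(_ * N)%N]mulnAC mulnA.
    by rewrite -add1n leq_add.
  by rewrite expnMn ltn_pmul2r // expn_gt0.
pose mE (a : E) : 'X_{1..r} := [multinom (a i : nat) | i < r].
pose mC (c : C) : 'X_{1..n} :=
  [multinom if insub i is Some z then c z : nat else 0%N | i < n].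
pose H (a : E) : S := \prod_(i < r) tnth h i ^+ mE a i.
(* More rows than columns: a nonzero vector of the left kernel gives the coefficients of G. *)
pose A := \matrix_(i < #|E|, j < #|C|) (H (enum_val i))@_(mC (enum_val j)).
have: kermx A != 0.
  rewrite kermx_eq0 /row_free neq_ltn (leq_ltn_trans (rank_leq_col A)) //.
case/rowV0Pn=> v /sub_kermxP vA nzv.
pose G : {mpoly K[r]} := \sum_(a : E) v 0 (enum_rank a) *: 'X_[mE a].
have mE_inj : injective mE.
  move=> a b /mnmP ab; apply/ffunP => i; apply: val_inj.
  by have := ab i; rewrite !mnmE.
have G_mE a : G@_(mE a) = v 0 (enum_rank a).
  rewrite raddf_sum (bigD1 a) //= mcoeffZ mcoeffX eqxx mulr1 big1 ?addr0 //.
  by move=> b nab; rewrite mcoeffZ mcoeffX (inj_eq mE_inj) (negPf nab) mulr0.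
exists G.
  apply: contraNneq nzv => G0; apply/eqP/rowP => j; rewrite mxE.
  by rewrite -(enum_valK j) -G_mE G0 mcoeff0.
have GH : G \mPo h = \sum_(a : E) v 0 (enum_rank a) *: H a.
  rewrite raddf_sum /=; apply: eq_bigr => a _.
  by rewrite comp_mpolyZ comp_mpolyX.
move=> m mZ; rewrite GH raddf_sum /=.
under eq_bigr => a _ do rewrite mcoeffZ.
(* No product [H a] contains a monomial of degree D or more. *)
case: (ltnP (mdeg m) D) => [ltmD | leDm]; last first.
  rewrite big1 // => a _; rewrite [X in _ * X]memN_msupp_eq0 ?mulr0 //.
  apply: msize_mdeg_ge; apply: leq_trans leDm.
  have := @msize_prod_bound _ (index_enum 'I_r)
    (fun i => tnth h i ^+ mE a i) (N * B).
  rewrite -sum1_size sum1_card card_ord; apply => i.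
  rewrite (leq_trans (msize_exp_bound _ (szh i))) // ltnS leq_mul2r.
  by rewrite mnmE ltnW ?orbT.
pose c : C := [ffun z => inord (m (val z))].
have mc : mC c = m.
  apply/mnmP => i; rewrite mnmE; case: insubP => [z Zi zi | nZi].
    rewrite ffunE zi inordK // (leq_ltn_trans _ ltmD) // mdegE (bigD1 i) //=.
    exact: leq_addr.
  by apply/esym/eqP; rewrite -leqn0 leqNgt; apply: contra nZi => /(mnm_onP _ _ mZ).
have := congr1 (fun w : 'rV_#|C| => w 0 (enum_rank c)) vA.
rewrite !mxE => vAc; rewrite -[RHS]vAc (reindex (@enum_val E E)) /=; last first.
  by apply: onW_bij; apply: enum_val_bij.
by apply: eq_bigr => j _; rewrite enum_valK mxE enum_rankK mc.
Qed.

Lemma monom_eval_comp r (h : r.-tuple S) (m : 'X_{1..r}) :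
  monom_eval h m = \prod_(i < r) tnth h i ^+ m i.
Proof.
rewrite monom_evalE ?size_tuple //; apply: eq_bigr => i _.
by rewrite (tnth_nth 0) (mnm_nth 0%N).
Qed.

(** Serves twice: with N a prime chain and A = S, and with N i = J + (h_1, ..., h_i) J' and A =
    J'. *)
Lemma strip_mpoly (A : S -> Prop) r (h : r.-tuple S) (N : nat -> S -> Prop)
    (G : {mpoly K[r]}) g :
  is_ideal A -> (forall i, is_ideal (N i)) ->
  (forall i, (i < r)%N -> forall x, A x -> N i (h`_i * x) -> N i x) ->
  (forall i, (i < r)%N -> forall x, A x -> N i.+1 (h`_i * x)) ->
  (forall i, (i < r)%N -> forall x, N i x -> N i.+1 x) ->
  G != 0 -> A g -> N 0%N ((G \mPo h) * g) -> N r g.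
Proof.
move=> idA idN reg kill inc nzG Ag NGg.
pose T := [seq (tval (val m), mpolyC n (G@_m)) | m : 'X_{1..r} <- msupp G].
rewrite -(size_tuple h); apply: (@strip_relation _ A h N T) => //.
- by rewrite size_tuple.
- by rewrite size_tuple.
- by rewrite size_tuple.
- by rewrite -size_eq0 size_map size_eq0 msupp_eq0.
- rewrite -map_comp map_inj_uniq ?msupp_uniq //.
  by move=> a b /= /val_inj/val_inj.
- move=> _ /mapP[m Gm ->] /=; split; first by rewrite !size_tuple.
  exists ((G@_m)^-1)%:MP; rewrite -mpolyCM mulVf //.
  by rewrite -mcoeff_msupp.
suff <- : G \mPo h = \sum_(p <- T) p.2 * monom_eval h p.1 by [].
rewrite big_map comp_mpolyE; apply: eq_bigr => m _ /=.
by rewrite monom_eval_comp mul_mpolyC.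
Qed.

End AlgebraicDependence.

(** * Clean filtrations and Cohen-Macaulay quotients *)

Section CleanFiltrations.
Variables (K : fieldType) (n : nat).
Local Notation S := {mpoly K[n]}.
Implicit Types (I J : S -> Prop) (Z : {set 'I_n}) (m : 'X_{1..n}) (p : S).

(* J' / J is isomorphic to S / P_Z with #|Z| = d, so of dimension d. *)
Definition prime_factor d J J' :=
  [/\ is_ideal J, is_ideal J', forall p, J p -> J' p
    & exists f Z, [/\ #|Z| = d, J' f, forall p, J' p -> exists a, J (p - a * f)
        & forall p, J (p * f) <-> coord_prime Z p]].

(** Transitive but not reflexive closure: at least one factor, hence a nonzero module, as the zero
    module has no dimension. *)
Definition clean_filtration d := clos_trans (S -> Prop) (prime_factor d).

Lemma clean_filtrationP d J J' : clean_filtration d J J' ->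
  [/\ is_ideal J, is_ideal J' & forall p, J p -> J' p].
Proof.
elim=> [I I' [] // | I1 I2 I3 _ [id1 _ s12] _ [_ id3 s23]].
by split=> // p /s12 /s23.
Qed.

Lemma clean_weakly_regular d J J' :
  clean_filtration d J J' -> weakly_regular J J' (esyms K n d).
Proof.
elim=> [I I' [idI idI' sI [f [Z [cZ I'f genf annf]]]] |
        I1 I2 I3 /clean_filtrationP[id1 id2 s12] r12
        /clean_filtrationP[_ id3 s23] r23].
  apply: (weakly_regular_iso (h := f)) (weakly_regular_esyms K cZ) => //.
  - exact: coord_prime_ideal.
  - by move=> x _; apply: (idealMr _ idI').
  - by move=> y /genf[a Ia]; exists a => //; rewrite mulrC.
  - by move=> x _; rewrite mulrC; apply: annf.
exact: weakly_regular_ext r12 r23.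
Qed.

(** The top factor is cyclic with annihilator P_Z. If its generator f were in (fs) f, then 1 - q
    would lie in P_Z for some q without constant term; but elements of P_Z have no constant term. *)
Lemma clean_nakayama d J J' : clean_filtration d J J' ->
  exists2 g, J' g & forall fs, (forall f, f \in fs -> max_graded_ideal f) ->
    ~ add_mul J fs J' g.
Proof.
elim=> [I I' [idI idI' sI [f [Z [cZ I'f genf annf]]]] |
        I1 I2 I3 /clean_filtrationP[id1 id2 s12] _ _ [g I3g ng]]; last first.
  exists g => // fs /ng {}ng; apply: contra_not ng; apply: add_mul_min.
  - exact: add_mul_ideal.
  - by move=> p /s12; apply: add_mull.
  - by move=> h p; apply: add_mulr.
exists f => // fs fsm add_f.
pose L p := exists2 q : S, q@_0%MM = 0 & I (p - q * f).
have: L f.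
  move: add_f; apply: add_mul_min.
  - split=> [|p q [a a0 Ia] [b b0 Ib] | p q [b b0 Ib]].
    + by exists 0; rewrite ?mcoeff0 // mul0r subrr; apply: (ideal0 idI).
    + exists (a + b); first by rewrite mcoeffD a0 b0 addr0.
      by rewrite mulrDl opprD addrACA; apply: (idealD idI).
    + exists (p * b); first by rewrite rmorphM /= b0 mulr0.
      by rewrite -mulrA -mulrBr; apply: (idealM _ idI).
  - by move=> p Ip; exists 0; rewrite ?mcoeff0 // mul0r subr0.
  - move=> h g /fsm/max_graded_idealP h0 /genf[a Ia]; exists (h * a).
      by rewrite rmorphM /= h0 mul0r.
    by rewrite -mulrA -mulrBr; apply: (idealM _ idI).
have on0 : mnm_on Z 0%MM by apply/mnm_onP => i; rewrite mnm0E.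
case=> q q0; rewrite -{1}[f]mul1r -mulrBl => /annf/(_ _ on0)/eqP.
by rewrite mcoeffB q0 subr0 mcoeff1 eqxx oner_eq0.
Qed.

(** The product of one relation per factor kills the whole module, and is nonzero in a domain. *)
Lemma clean_dependent d J J' r (h : r.-tuple S) :
  clean_filtration d J J' -> (d < r)%N ->
  exists2 G : {mpoly K[r]}, G != 0 & annihilator J J' (G \mPo h).
Proof.
move=> clean_J ltdr; elim: clean_J => [I I' [idI idI' sI [f [Z [cZ I'f genf annf]]]] |
        I1 I2 I3 _ [G1 nz1 ann1] _ [G2 nz2 ann2]].
  rewrite -cZ in ltdr; have [G nzG ZG] := coord_prime_dependent h ltdr.
  exists G => // p /genf[a Ia]; apply: (idealBr idI (g := (G \mPo h) * a * f)).
    by rewrite mulrAC mulrC; apply/(idealM _ idI)/annf.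
  by rewrite -mulrA -mulrBr; apply: (idealM _ idI).
exists (G1 * G2); first by rewrite mulf_neq0.
by move=> p I3p; rewrite rmorphM /= -mulrA; apply/ann1/ann2.
Qed.

(** P_Z is the annihilator of the bottom factor, a submodule of J' / J. *)
Lemma clean_ann_prime d J J' : clean_filtration d J J' ->
  exists2 Z : {set 'I_n}, #|Z| = d & forall p, annihilator J J' p -> coord_prime Z p.
Proof.
elim=> [I I' [idI idI' sI [f [Z [cZ I'f genf annf]]]] |
        I1 I2 I3 _ [Z cZ annZ] /clean_filtrationP[_ _ s23] _].
  by exists Z => // p annp; apply/annf/annp.
by exists Z => // p annp; apply: annZ => g /s23; apply: annp.
Qed.

Lemma finite_choice (P : nat -> S -> Prop) k :
  (forall i, (i < k)%N -> exists p, P i p) ->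
  exists h : k.-tuple S, forall i, (i < k)%N -> P i h`_i.
Proof.
move=> exP; have [s <- sP] : exists2 s : seq S, size s = k &
    forall i, (i < k)%N -> P i s`_i.
  elim: k exP => [|k IH] exP; first by exists [::].
  have [|s sz sP] := IH _; first by move=> i lt_i; apply: exP; apply: ltnW.
  have [p Pp] := exP k (ltnSn k).
  exists (rcons s p); first by rewrite size_rcons sz.
  move=> i; rewrite ltnS leq_eqVlt nth_rcons sz => /predU1P[-> | lt_i].
    by rewrite ltnn eqxx.
  by rewrite lt_i; apply: sP.
by exists (in_tuple s).
Qed.

(** Removing the elements of Z one by one gives a chain from P_Z up to the prime of the empty
    set. *)
Lemma coord_prime_chain Z (A : S -> Prop) :
  (forall p, A p -> coord_prime Z p) -> exists Q, prime_chain A #|Z| Q.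
Proof.
move=> AZ; exists (fun i => coord_prime (Z :\: [set x in take i (enum Z)])).
split=> [i _ | i _ p /AZ | i lt_i]; first exact: coord_prime_prime.
  by apply: coord_primeS; apply: subsetDl.
set x := enum_val (Ordinal lt_i).
have x_i : x = nth x (enum Z) i by rewrite {1}/x (enum_val_nth x).
split.
  move=> f; apply: coord_primeS; apply: setDS; apply/subsetP => y; rewrite !inE.
  rewrite (take_nth x) -?cardE // mem_rcons inE => ->; exact: orbT.
exists 'X_x; first apply/coord_primeXU.
  rewrite !inE (take_nth x) -?cardE // mem_rcons inE -x_i eqxx.
  by [].
move/coord_primeXU; rewrite !inE enum_valP andbT => /negP; apply.
have := enum_uniq Z; rewrite -{1}(cat_take_drop i (enum Z)) cat_uniq.
case/and3P=> _ /hasPn nx _. apply: nx.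
by rewrite (drop_nth x) -?cardE // -x_i mem_head.
Qed.

Lemma clean_CohenMacaulay d J J' :
  clean_filtration d J J' -> CohenMacaulay_of_dim J J' d.
Proof.
move=> clean_J; have [idJ idJ' sJ] := clean_filtrationP clean_J.
split; split.
- by have [Z <- /coord_prime_chain] := clean_ann_prime clean_J.
- move=> k Q [primeQ annQ incQ]; rewrite leqNgt; apply/negP => ltdk.
  (* Such an h_i is a nonzerodivisor modulo the prime Q_i and vanishes modulo Q_(i+1). *)
  have [|h hQ] := @finite_choice (fun i p => Q i.+1 p /\ ~ Q i p) k.
    by move=> i /incQ[_ [p]]; exists p.
  have [G nzG annG] := clean_dependent h clean_J ltdk.
  have [_ Qk1 _] := primeQ k (leqnn k); apply: Qk1.
  suff: Q (minn k k) 1 by rewrite minnn.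
  (* The [minn] freezes the chain beyond k, where nothing is known about Q; with g = 1 the
     conclusion is 1 in Q_k. *)
  apply: (@strip_mpoly K n (fun=> True) k h (fun i => Q (minn i k)) G) => //.
  - by move=> i; have [] := primeQ (minn i k) (geq_minr i k).
  - move=> i lt_i p _; rewrite (minn_idPl (ltnW lt_i)).
    by have [_ _ /[apply] -[]] := primeQ i (ltnW lt_i); have [_] := hQ i lt_i.
  - move=> i lt_i p _; rewrite (minn_idPl lt_i).
    by have [idQ _ _] := primeQ i.+1 lt_i; apply: (idealMr _ idQ);
      have [] := hQ i lt_i.
  - move=> i lt_i p; rewrite (minn_idPl lt_i) (minn_idPl (ltnW lt_i)).
    by have [+ _] := incQ i lt_i; apply.
  by rewrite min0n mulr1; apply: annQ.
- exists (esyms K n d); split; last exact: size_esyms.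
    by move=> f; apply: esyms_max.
  split.
    by apply: weakly_regularP => //; apply: clean_weakly_regular.
  have [g J'g ng] := clean_nakayama clean_J; exists g => //; apply: ng.
  by move=> f; apply: esyms_max.
move=> fs fsm [reg [g J'g ng]]; rewrite leqNgt; apply/negP => ltd.
have [G nzG annG] := clean_dependent (in_tuple fs) clean_J ltd.
apply: ng; rewrite -(take_size fs).
apply: (@strip_mpoly K n J' (size fs) (in_tuple fs)
  (fun i => add_mul J (take i fs) J') G) => //.
- by move=> i; apply: add_mul_ideal.
- move=> i lt_i p J'p; apply: add_mulr => //.
  by rewrite (take_nth 0) // mem_rcons mem_head.
- move=> i lt_i p; apply: add_mul_sub => f.
  by rewrite (take_nth 0) // mem_rcons inE => ->; rewrite orbT.
by apply: add_mull; apply: annG.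
Qed.

(** Clean filtrations with the same d compose, so neighbouring factors of equal dimension merge into
    one. *)
Lemma sequentially_CohenMacaulay_clean (E : nat -> S -> Prop) (dimE : nat -> nat) r :
  (forall i, (i <= r)%N -> graded_ideal (E i)) ->
  (forall i, (i < r)%N -> clean_filtration (dimE i) (E i) (E i.+1)) ->
  (forall i, (i.+1 < r)%N -> (dimE i <= dimE i.+1)%N) ->
  sequentially_CohenMacaulay (E 0%N) (E r).
Proof.
move=> gradE cleanE leE.
(* The last clause records the dimension of the last merged factor, with which the next one is
   compared. *)
suff [k [F [dimF [[F0 Fk] gradF cleanF ltF _]]]] : exists k F dimF,
   [/\ F 0%N = E 0%N /\ F k = E r,
       forall i, (i <= k)%N -> graded_ideal (F i),
       forall i, (i < k)%N -> clean_filtration (dimF i) (F i) (F i.+1),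
       forall i, (i.+1 < k)%N -> (dimF i < dimF i.+1)%N
     & if r is r'.+1 then (0 < k)%N /\ dimF k.-1 = dimE r' else k = 0%N].
  exists k, F, dimF; split=> //.
  - by rewrite F0 Fk.
  - by move=> i /cleanF/clean_filtrationP[].
  - by move=> i /cleanF/clean_CohenMacaulay.
elim: r gradE cleanE leE => [|r IH] gradE cleanE leE.
  by exists 0%N, E, dimE; split.
have [||| k [F [dimF [[F0 Fk] gradF cleanF ltF dimr]]]] := IH.
- by move=> i le_i; apply: gradE; apply: leqW.
- by move=> i lt_i; apply: cleanE; apply: leqW.
- by move=> i lt_i; apply: leE; apply: leqW.
have [eq_d | ne_d] : (0 < r)%N && (dimE r.-1 == dimE r) \/
    ((0 < r)%N -> (dimE r.-1 < dimE r)%N).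
  case: r leE {IH gradE cleanE Fk dimr} => [|r] leE; first by right.
  by have := leE r (leqnn _); rewrite leq_eqVlt => /orP[]; [left | right].
- case: r eq_d leE gradE cleanE Fk dimr {IH} => [//|r] /= /eqP eq_d
    leE gradE cleanE Fk dimr.
  case: k dimr Fk gradF cleanF ltF => [[]//|k] /= [_ dimk] Fk gradF cleanF ltF.
  (* Equal dimensions: the last factor is enlarged. *)
  exists k.+1, (fun i => if i == k.+1 then E r.+2 else F i), dimF; split=> //.
  + by rewrite eqxx.
  + move=> i; case: eqP => [_ _ | _]; [exact: gradE | exact: gradF].
  + move=> i lt_i; rewrite (ltn_eqF lt_i) eqSS; case: eqP => [-> | _].
      apply: t_trans (cleanF k _) _ => //.
      by rewrite Fk dimk eq_d; apply: cleanE.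
    exact: cleanF.
  + by split=> //; rewrite dimk.
(* Larger dimension, or first factor: a new step is appended. *)
exists k.+1, (fun i => if i == k.+1 then E r.+1 else F i),
  (fun i => if i == k then dimE r else dimF i); split=> //.
- by rewrite eqxx.
- move=> i; case: eqP => [_ _ | /eqP ne_i le_i]; first exact: gradE.
  by apply: gradF; rewrite -ltnS ltn_neqAle ne_i.
- move=> i lt_i; rewrite (ltn_eqF lt_i) eqSS; case: eqP => [-> | /eqP ne_i].
    by rewrite Fk; apply: cleanE.
  by apply: cleanF; rewrite ltn_neqAle ne_i.
- move=> i; rewrite ltnS => lt_i; rewrite (ltn_eqF lt_i).
  case: eqP => [ik | /eqP ne_i]; last by apply: ltF; rewrite ltn_neqAle ne_i.
  case: r ne_d dimr {leE gradE cleanE IH Fk} => [_ k0 | r ne_d [_ dimk]].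
    by rewrite k0 in lt_i.
  by have := ne_d isT; rewrite -dimk -ik.
- by split; rewrite //= eqxx.
Qed.

End CleanFiltrations.

(** * Monomial ideals and linear quotients *)

Section MonomialIdeals.
Variables (K : fieldType) (n : nat).
Local Notation S := {mpoly K[n]}.
Implicit Types (I J : S -> Prop) (Z : {set 'I_n}) (m : 'X_{1..n}) (p : S)
  (G : 'X_{1..n} -> Prop).

Definition upward_closed G := forall m m', G m -> G (m + m')%MM.

Definition mon_span G p := forall m, m \in msupp p -> G m.

Lemma mon_spanX G m : mon_span G 'X_[m] <-> G m.
Proof.
split=> [| Gm k]; first by apply; rewrite msuppX mem_head.
by rewrite msuppX inE => /eqP->.
Qed.

Lemma mon_span_ideal G : upward_closed G -> is_ideal (mon_span G).
Proof.
move=> upG; split=> [m | f g Gf Gg m | f g Gg m].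
- by rewrite msupp0.
- by move/msuppD_le; rewrite mem_cat => /orP[/Gf | /Gg].
- case/msuppM_le/allpairsP => -[m1 m2] /= [_ /Gg G2 ->].
  by rewrite addmC; apply: upG.
Qed.

Lemma mon_span_graded G : upward_closed G -> graded_ideal (mon_span G).
Proof.
move=> /mon_span_ideal idG; split=> // p d Gp; rewrite pihomogE -big_filter.
apply: (ideal_sum idG) => m; rewrite mem_filter => /andP[_ /Gp Gm].
by rewrite -mul_mpolyC; apply/(idealM _ idG)/mon_spanX.
Qed.

Lemma lepmP m m' : (m <= m')%MM -> m' = (m + (m' - m))%MM.
Proof.
by move=> /mnm_lepP le_m; apply/mnmP => i; rewrite mnmDE mnmBE subnKC.
Qed.

Lemma lepm_addr m m' : (m <= m + m')%MM.
Proof. by apply/mnm_lepP => i; rewrite mnmDE leq_addr. Qed.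

Lemma up_mon_multiples G : upward_closed (fun m => exists2 w, G w & (w <= m)%MM).
Proof.
move=> m m' [w Gw le_w]; exists w => //.
exact: lepm_trans le_w (lepm_addr _ _).
Qed.

Lemma mon_idealP G p :
  mon_ideal G p <-> mon_span (fun m => exists2 w, G w & (w <= m)%MM) p.
Proof.
split=> [|Gp].
  move/(_ (mon_span (fun m => exists2 w, G w & (w <= m)%MM))); apply.
    exact/mon_span_ideal/up_mon_multiples.
  by move=> _ [w Gw ->]; apply/mon_spanX; exists w; rewrite ?lepm_refl.
have idG : is_ideal (@mon_ideal K n G) by apply: ideal_gen_ideal.
apply: (ideal_mpoly idG) => m /Gp[w Gw /lepmP->].
rewrite mpolyXD; apply: (idealMr _ idG).
by apply: ideal_gen_sub; exists w.
Qed.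

(** The last hypothesis says that the colon ideal of [mon_span G] by x^f is P_Z. *)
Lemma mon_span_prime_factor G G' (f : 'X_{1..n}) Z :
  upward_closed G -> upward_closed G' ->
  (forall m, G' m <-> G m \/ (f <= m)%MM) ->
  (forall m, G (m + f)%MM <-> ~~ mnm_on Z m) ->
  prime_factor #|Z| (mon_span G) (@mon_span G').
Proof.
move=> upG upG' eqG' colonG.
have [idG idG'] := (mon_span_ideal upG, mon_span_ideal upG').
split=> // [p Gp m /Gp Gm|]; first by apply/eqG'; left.
exists 'X_[f], Z; split=> //.
- by apply/mon_spanX/eqG'; right; apply: lepm_refl.
- move=> p G'p; suff [a _ Ga]: add_prod (mon_span G) 'X_[f] (fun=> True) p.
    by exists a; rewrite mulrC.
  have idL := add_prod_ideal 'X_[f] idG (@ideal_full S).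
  apply: (ideal_mpoly idL) => m /G'p/eqG'[Gm | /lepmP ->].
    by apply: add_prodl => //; apply/mon_spanX.
  by rewrite mpolyXD; apply: add_prodr.
move=> p; split=> [Gpf m mZ | Zp m].
  apply/eqP/negPn/negP; rewrite -(mcoeffMX p f) -mcoeff_msupp addmC => /Gpf.
  by move/colonG; rewrite mZ.
rewrite (perm_mem (msuppMX p f)) => /mapP[m' pm' ->].
rewrite addmC; apply/colonG; apply: contraL pm' => /Zp.
by rewrite mcoeff_msupp => ->; rewrite eqxx.
Qed.

Lemma clean_filtration_eq d I I' J J' :
  (forall p, I p <-> I' p) -> (forall p, J p <-> J' p) ->
  clean_filtration d I J -> clean_filtration d I' J'.
Proof.
have ideal_eq (A B : S -> Prop) :
    (forall p, A p <-> B p) -> is_ideal A -> is_ideal B.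
  move=> AB [A0 AD AM]; split=> [|f g /AB Af /AB Ag | f g /AB Ag]; apply/AB => //.
    exact: AD.
  exact: AM.
move=> eqI eqJ clean_J; elim: clean_J I' J' eqI eqJ => {I J}
    [I J [idI idJ sIJ [f [Z [cZ Jf genf annf]]]] I' J' eqI eqJ |
     I1 I2 I3 _ IH12 _ IH23 I' J' eqI eqJ].
  apply: t_step; split; try exact: ideal_eq; first by move=> p /eqI/sIJ/eqJ.
  exists f, Z; split=> //; first exact/eqJ.
    by move=> p /eqJ/genf[a Ia]; exists a; apply/eqI.
  by move=> p; rewrite -eqI.
by apply: t_trans (IH12 I' I2 eqI _) (IH23 I2 J' _ eqJ).
Qed.

(** Linear quotients relative to G: every colon ideal is generated by all but d of the variables. *)
Lemma clean_monomial_list (T : eqType) (L : seq T) (mon : T -> 'X_{1..n})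
    (Z : T -> {set 'I_n}) d G :
  upward_closed G -> L != [::] -> (forall x, x \in L -> #|Z x| = d) ->
  (forall L1 x L2, L = L1 ++ x :: L2 -> forall m,
     G (m + mon x)%MM \/ (exists2 y, y \in L1 & (mon y <= m + mon x)%MM)
     <-> ~~ mnm_on (Z x) m) ->
  clean_filtration d (mon_span G)
    (@mon_span (fun m => G m \/ exists2 y, y \in L & (mon y <= m)%MM)).
Proof.
move=> upG nzL cZ colonL.
pose H (s : seq T) m := G m \/ exists2 y, y \in s & (mon y <= m)%MM.
have upH s : upward_closed (H s).
  move=> m m' [Gm | [y sy le_y]]; first by left; apply: upG.
  by right; exists y => //; apply: lepm_trans le_y (lepm_addr _ _).
have HG p : mon_span (H [::]) p <-> mon_span G p.
  by split=> Gp m /Gp; [case=> // -[] | left].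
(* Only nonempty prefixes, since a clean filtration has at least one factor. *)
suff clean_prefix L1 x L2 : L = rcons L1 x ++ L2 ->
    clean_filtration d (mon_span G) (@mon_span (H (rcons L1 x))).
  case/lastP: L nzL {cZ colonL} clean_prefix => // L1 x _ /(_ L1 x [::]).
  by apply; rewrite cats0.
elim/last_ind: L1 x L2 => [|L1 y IH] x L2 Leq.
  apply: (clean_filtration_eq HG (J := @mon_span (H [:: x]))) => [p|]; first by [].
  have Lx : x \in L by rewrite Leq /= mem_head.
  apply: t_step; rewrite -(cZ x Lx);
    apply: (mon_span_prime_factor (f := mon x)) => // m.
    split=> [[Gm | [y]] | [[Gm | [//]] | le_x]].
    - by left; left.
    - by rewrite inE => /eqP->; right.
    - by left.
    by right; exists x; rewrite ?mem_head.
  exact: (colonL [::] x L2).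
have Lx : x \in L by rewrite Leq mem_cat mem_rcons mem_head.
apply: t_trans (IH y (x :: L2) _) _; first by rewrite Leq cat_rcons.
apply: t_step; rewrite -(cZ x Lx);
  apply: (mon_span_prime_factor (f := mon x)) => // m.
  split=> [[Gm | [z]] | [[Gm | [z sz le_z]] | le_x]].
  - by left; left.
  - by rewrite mem_rcons inE => /predU1P[-> | sz le_z]; [right | left; right;
      exists z].
  - by left.
  - by right; exists z; rewrite // mem_rcons inE sz orbT.
  by right; exists x; rewrite // mem_rcons mem_head.
by apply: (colonL _ x L2); rewrite Leq cat_rcons.
Qed.

End MonomialIdeals.

(** * Combinatorics of t-spread index sequences *)

Section SpreadSequences.
Variable t : nat.
Local Open Scope nat_scope.
Implicit Types (a c x y : nat) (b s : seq nat).

Definition spread : rel nat := fun x y => x + t <= y.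

Lemma spread_trans : transitive spread.
Proof. by move=> y x z; rewrite /spread; lia. Qed.

Lemma sorted_spread_cons x s :
  sorted spread (x :: s) = all (spread x) s && sorted spread s.
Proof. exact/path_sortedE/spread_trans. Qed.

Lemma sorted_spread_leq s : sorted spread s -> sorted leq s.
Proof. by apply: sub_sorted => x y; rewrite /spread; lia. Qed.

Lemma sorted_spread_ltn s : 0 < t -> sorted spread s -> sorted ltn s.
Proof. by move=> t_gt0; apply: sub_sorted => x y; rewrite /spread /ltn /=; lia. Qed.

Lemma sorted_spread_rcons s c :
  sorted spread (rcons s c) = all (spread^~ c) s && sorted spread s.
Proof.
elim: s => [|x s IH]; first by [].
rewrite rcons_cons !sorted_spread_cons all_rcons IH /=.
by case: (spread x c); rewrite ?andbF //= andbCA.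
Qed.

(** The index sequences of the generators of B_t(x_b). *)
Definition admissible b s := sorted spread s && all2 leq s b.

Lemma admissible_size b s : admissible b s -> size s = size b.
Proof. by case/andP=> _; rewrite all2E => /andP[/eqP]. Qed.

Lemma all2_leq_all (P : pred nat) b s :
  (forall x y, x <= y -> P y -> P x) -> all P b -> all2 leq s b -> all P s.
Proof.
move=> P_le; elim: s b => //= x s IH [//|b1 b] /= /andP[Pb1 Pb] /andP[xb1 sb].
by rewrite (P_le x b1) // (IH b).
Qed.

Lemma all2_leq_bound b c s :
  all (leq^~ c) b -> all2 leq s b -> all (leq^~ c) s.
Proof. by apply: all2_leq_all => x y; apply: leq_trans. Qed.

Lemma admissible_take b s k : admissible b s -> admissible (take k b) (take k s).
Proof.
case/andP=> sort_s le_sb; rewrite /admissible (take_sorted _ sort_s) /=.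
by elim: s b k le_sb {sort_s} => [|x s IH] [|b1 b] [|k] //= /andP[-> /IH ->].
Qed.

Definition in_block s y := has (fun x => x <= y < x + t) s.

(** If a lies beyond all blocks it is appended, under the bound c; otherwise it replaces the next
    larger entry, which lowers the sum. Being outside the blocks keeps a at distance t from the
    entries on its left. *)
Lemma admissible_exchange b c s a :
  admissible b s -> a <= c -> ~~ in_block s a ->
  exists2 s', {subset s' <= a :: s} &
    admissible (rcons b c) s' \/ admissible b s' /\ sumn s' < sumn s.
Proof.
rewrite /admissible => + le_ac.
elim: s b => [|x s IH] [|b1 b] /=; rewrite ?andbF //.
  by move=> _ _; exists [:: a] => //; left; rewrite /= le_ac.
rewrite -/(sorted spread (x :: s)) sorted_spread_cons negb_or.
case/andP=> /andP[xs sort_s] /andP[xb1 sb] /andP[nax nas].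
case: (ltnP a x) => [lt_ax | le_xa].
  exists (a :: s).
    by move=> y; rewrite !inE => /orP[->|->]; rewrite ?orbT.
  right; rewrite sorted_spread_cons sort_s /= sb (leq_trans (ltnW lt_ax) xb1).
  split; last by rewrite ltn_add2r.
  by rewrite !andbT; apply: sub_all xs => y; rewrite /spread; lia.
have xa : spread x a by move: nax; rewrite /spread; lia.
have [|s' s's adm_s'] := IH b _ nas; first by rewrite sort_s sb.
have xs' : all (spread x) s'.
  apply/allP => y /s's; rewrite inE => /predU1P[-> // | sy].
  exact: (allP xs).
exists (x :: s').
  move=> y; rewrite !inE => /predU1P[-> | /s's]; first by rewrite eqxx orbT.
  by rewrite inE => /orP[->|->]; rewrite ?orbT.
rewrite !sorted_spread_cons xs' /= xb1 ltn_add2l.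
by case: adm_s' => [| [? ?]]; [left | right].
Qed.

(** A block of length t holds at most one entry of s'. At equal sizes each block holds exactly one,
    which is at least the left end of the block. *)
Lemma blocks_dominate s s' : sorted spread s -> sorted spread s' ->
  all (in_block s) s' ->
  size s' <= size s /\
  (size s' = size s -> sumn s <= sumn s' /\ (sumn s' = sumn s -> s' = s)).
Proof.
elim: s s' => [|x s IH] [|y s'] //.
rewrite !sorted_spread_cons => /andP[xs sort_s] /andP[ys' sort_s'].
case/andP=> in_y in_s'.
have le_xy : x <= y.
  case/orP: in_y => [/andP[] // | /hasP[z sz /andP[le_zy _]]].
  by have := allP xs z sz; rewrite /spread; lia.
(* Entries after y are at least x + t, so they miss the first block. *)
have in_s'' : all (in_block s) s'.
  apply/allP => z s'z; have /orP[|//] := allP in_s' z s'z.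
  by have := allP ys' z s'z; rewrite /spread; lia.
have [le_sz eq_sz] := IH s' sort_s sort_s' in_s''.
split=> // -[/eq_sz[le_sum eq_sum]] /=; split; first by lia.
move=> eq_add; have exy : y = x by lia.
by rewrite exy eq_sum //; lia.
Qed.

Lemma all2_leq_count b s : all2 leq s b ->
  forall v, count (leq^~ v) b <= count (leq^~ v) s.
Proof.
move=> + v; elim: s b => [|x s IH] [|b1 b] //= /andP[xb1 /IH].
by case: (leqP b1 v) => [|_]; case: (leqP x v) => /=; lia.
Qed.

(** Counting ignores order, so domination survives the re-sorting after an exchange in
    [admissible_lower]. *)
Lemma count_all2_leq b s : sorted leq s -> sorted leq b -> size s = size b ->
  (forall v, count (leq^~ v) b <= count (leq^~ v) s) -> all2 leq s b.
Proof.
elim: s b => [|x s IH] [|b1 b] //=; rewrite !(path_sortedE leq_trans).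
move=> /andP[xs sort_s] /andP[b1b sort_b] [sz] le_count.
have xb1 : x <= b1.
  rewrite leqNgt; apply/negP => lt_b1x.
  have := le_count b1; rewrite leqnn (leqNgt x) lt_b1x.
  suff -> : count (leq^~ b1) s = 0 by [].
  apply/eqP; rewrite eqn0Ngt -has_count; apply/hasPn => z sz_.
  by have := allP xs z sz_; rewrite /=; lia.
rewrite xb1; apply: IH => // v; have := le_count v.
case: (leqP b1 v) => [le_b1v | lt_vb1]; first by rewrite (leq_trans xb1 le_b1v).
suff -> : count (leq^~ v) b = 0 by [].
apply/eqP; rewrite eqn0Ngt -has_count; apply/hasPn => z bz.
by have := allP b1b z bz; rewrite /=; lia.
Qed.

Lemma admissible_lower b s s' r i j : sorted leq b -> admissible b s ->
  sorted spread s' -> i <= j -> perm_eq s (j :: r) -> perm_eq s' (i :: r) ->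
  admissible b s'.
Proof.
move=> sort_b /andP[sort_s le_sb] sort_s' le_ij perm_s perm_s'.
rewrite /admissible sort_s' /=.
apply: count_all2_leq => //; first exact: sorted_spread_leq.
  rewrite (perm_size perm_s') /= -[in RHS](eqP (_ : size s == size b)).
    by rewrite (perm_size perm_s).
  by move: le_sb; rewrite all2E => /andP[].
move=> v; apply: leq_trans (all2_leq_count le_sb v) _.
rewrite (permP perm_s' _) (permP perm_s _) /= leq_add2r.
by case: (leqP j v) => // le_jv; rewrite (leq_trans le_ij le_jv).
Qed.

End SpreadSequences.

(** * The sets Z and their cardinality *)

Section BlockSets.
Variables (n t : nat).
Local Open Scope nat_scope.
Implicit Types (c : nat) (s : seq nat).

Lemma card_ord_ltn c : c <= n -> #|[set i : 'I_n | i < c]| = c.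
Proof.
move=> le_cn; rewrite -sum1dep_card -(big_ord_widen _ (fun _ => 1)) //=.
by rewrite sum1_card card_ord.
Qed.

Definition free_vars c s := [set i : 'I_n | (c < i) || in_block t s i].

(** The blocks are disjoint, have t elements each and do not go beyond c. *)
Lemma card_free_vars c s : c < n -> sorted (spread t) s ->
  all (fun x => x + t <= c.+1) s -> #|free_vars c s| = n - c.+1 + size s * t.
Proof.
move=> lt_cn; elim: s => [_ _ | x s IH].
  have -> : free_vars c [::] = ~: [set i : 'I_n | i < c.+1].
    by apply/setP => i; rewrite !inE orbF ltnNge ltnS.
  by rewrite cardsCs setCK card_ord_ltn // card_ord addn0.
rewrite sorted_spread_cons => /andP[xs sort_s] /= /andP[xc sc].
have -> : free_vars c (x :: s) =
    ([set i : 'I_n | i < x + t] :\: [set i : 'I_n | i < x]) :|: free_vars c s.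
  apply/setP => i; rewrite !inE /=.
  by rewrite -leqNgt orbCA.
rewrite cardsU cardsD (setIidPr _); last first.
  by apply/subsetP => i; rewrite !inE; lia.
rewrite !card_ord_ltn; [|lia|lia].
rewrite (_ : _ :&: _ = set0) ?cards0; last first.
  apply/setP => i; rewrite !inE; apply/negP => /andP[/andP[le_xi lt_i]].
  case/orP=> [lt_ci | /hasP[y sy /andP[le_yi _]]]; first by lia.
  by have := allP xs y sy; rewrite /spread; lia.
by rewrite IH // mulSn; lia.
Qed.

End BlockSets.

(** * Monomials of index sequences *)

Section MonOfSeq.
Variable n : nat.
Implicit Types (s : seq 'I_n) (m : 'X_{1..n}) (i : 'I_n).

Lemma mon_of_seq_cons i s : mon_of_seq (i :: s) = (U_(i) + mon_of_seq s)%MM.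
Proof. by rewrite /mon_of_seq big_cons. Qed.

Lemma mon_of_seqE s i : mon_of_seq s i = count_mem i s.
Proof.
elim: s => [|j s IH]; first by rewrite /mon_of_seq big_nil mnm0E.
by rewrite mon_of_seq_cons mnmDE mnm1E IH.
Qed.

Lemma mon_of_seq_gt0 s i : (0 < mon_of_seq s i)%N = (i \in s).
Proof. by rewrite mon_of_seqE -has_count has_pred1. Qed.

Lemma mon_of_seq_perm s s' : (mon_of_seq s = mon_of_seq s') <-> perm_eq s s'.
Proof.
split=> [eq_m | perm_s]; last exact: perm_big.
by apply/allP => i _ /=; rewrite -!mon_of_seqE eq_m.
Qed.

Lemma mdeg_mon_of_seq s : mdeg (mon_of_seq s) = size s.
Proof.
elim: s => [|i s IH]; first by rewrite /mon_of_seq big_nil mdeg0.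
by rewrite mon_of_seq_cons mdegD mdeg1 IH.
Qed.

Lemma mon_of_seq_lep s m :
  (mon_of_seq s <= m)%MM -> forall i, i \in s -> (0 < m i)%N.
Proof. by move=> /mnm_lepP le_m i; rewrite -mon_of_seq_gt0 => /leq_trans->. Qed.

Lemma lep_mon_of_seq s m :
  uniq s -> (forall i, i \in s -> (0 < m i)%N) -> (mon_of_seq s <= m)%MM.
Proof.
move=> uniq_s sm; apply/mnm_lepP => i; rewrite mon_of_seqE count_uniq_mem //.
by case: (boolP (i \in s)) => // /sm.
Qed.

Lemma lep_mdeg_eq m m' : (m <= m')%MM -> mdeg m = mdeg m' -> m = m'.
Proof.
move=> /lepmP -> /eqP; rewrite mdegD -{1}[mdeg m]addn0 eqn_add2l eq_sym mdeg_eq0.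
by move=> /eqP->; rewrite addm0.
Qed.

End MonOfSeq.

(** * The factors I_m / I_(m+1) *)

Section BorelMonomials.
Variables (n t : nat).
Hypothesis t_gt0 : (0 < t)%N.
Implicit Types (s : seq 'I_n) (m : 'X_{1..n}) (b : seq nat).

Lemma sorted_spread_map s :
  sorted (fun i j : 'I_n => (i + t <= j)%N) s = sorted (spread t) (map val s).
Proof. by rewrite sorted_map. Qed.

Lemma sorted_spread_uniq s : sorted (spread t) (map val s) -> uniq s.
Proof.
move=> /(sorted_spread_ltn t_gt0)/(sorted_uniq ltn_trans ltnn).
by rewrite map_inj_uniq //; apply: val_inj.
Qed.

Lemma admissible_uniq b s : admissible t b (map val s) -> uniq s.
Proof. by case/andP=> /sorted_spread_uniq. Qed.

Definition borel_mon b m :=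
  exists2 s, admissible t b (map val s) & (mon_of_seq s <= m)%MM.

Lemma borel_mon_up b : upward_closed (borel_mon b).
Proof.
move=> m m' [s adm_s le_s]; exists s => //.
exact: lepm_trans le_s (lepm_addr _ _).
Qed.

(** I_(m+1) lies in I_m: dropping the last index of a generator leaves a divisor. *)
Lemma borel_mon_rcons b c m : borel_mon (rcons b c) m -> borel_mon b m.
Proof.
case=> s /(admissible_take (size b)); rewrite -cats1 take_size_cat //.
rewrite -map_take => adm_s le_s; exists (take (size b) s) => //.
apply: lep_mon_of_seq => [|i /mem_take]; first exact: admissible_uniq adm_s.
exact: mon_of_seq_lep le_s i.
Qed.

Lemma borel_mon_nil m : borel_mon [::] m.
Proof.
by exists [::] => //; apply/mnm_lepP => i; rewrite mon_of_seqE.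
Qed.

Lemma map_val_sub s (s' : seq nat) : {subset s' <= map val s} ->
  exists2 s1 : seq 'I_n, map val s1 = s' & {subset s1 <= s}.
Proof.
elim: s' => [|x s' IH] s's; first by exists [::].
have [|s1 def_s1 s1s] := IH; first by move=> y s'y; apply: s's; rewrite inE s'y orbT.
have /mapP[i si xi] := s's x (mem_head x s').
exists (i :: s1); first by rewrite /= def_s1 xi.
by move=> j; rewrite inE => /predU1P[-> | /s1s].
Qed.

(** The colon ideal of I_(m+1) + (L) by x_s is P_Z. L is constrained through sums only, so ties may
    be ordered arbitrarily. *)
Lemma borel_colon b c s (L : seq (seq 'I_n)) m :
  sorted (spread t) (rcons b c) -> admissible t b (map val s) ->
  {in L, forall s', [/\ admissible t b (map val s'), s' != s
                      & (sumn (map val s') <= sumn (map val s))%N]} ->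
  (forall s', admissible t b (map val s') ->
      (sumn (map val s') < sumn (map val s))%N -> s' \in L) ->
  borel_mon (rcons b c) (m + mon_of_seq s)%MM \/
    (exists2 s', s' \in L & (mon_of_seq s' <= m + mon_of_seq s)%MM)
  <-> ~~ mnm_on (free_vars n t c (map val s)) m.
Proof.
move=> sort_bc adm_s L_adm admL.
have := sort_bc; rewrite sorted_spread_rcons => /andP[bc sort_b].
have le_bc : all (leq^~ c) b.
  by apply: sub_all bc => y; rewrite /spread; lia.
have sort_s : sorted (spread t) (map val s) by case/andP: adm_s.
split=> [div_m | /forallPn[a]]; last first.
  rewrite negb_imply inE negb_or -leqNgt => /and3P[ma le_ac na].
  have [s' s'_as adm_s'] := admissible_exchange adm_s le_ac na.
  have [s1 def_s1 s1_as] := @map_val_sub (a :: s) s' s'_as.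
  rewrite -def_s1 in adm_s'.
  have s1_supp i : i \in s1 -> (0 < (m + mon_of_seq s)%MM i)%N.
    move/s1_as; rewrite inE mnmDE addn_gt0 mon_of_seq_gt0.
    by case/predU1P=> [->|->]; rewrite ?ma ?orbT.
  case: adm_s' => [adm1 | [adm1 lt_sum]].
    by left; exists s1 => //; apply: lep_mon_of_seq => //;
      apply: admissible_uniq adm1.
  right; exists s1; first exact: admL.
  by apply: lep_mon_of_seq => //; apply: admissible_uniq adm1.
apply/negP => /mnm_onP m_on.
(* The indices of s' come from s or from Z and are at most c, so they lie in the blocks of s. *)
have dominated s' : all (leq^~ c) (map val s') ->
    sorted (spread t) (map val s') -> (mon_of_seq s' <= m + mon_of_seq s)%MM ->
    (size s' <= size s)%N /\ (size s' = size s ->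
      (sumn (map val s) <= sumn (map val s'))%N /\
      (sumn (map val s') = sumn (map val s) -> s' = s)).
  move=> le_s'c sort_s' /mon_of_seq_lep s'_supp.
  have [|] := blocks_dominate sort_s sort_s'.
    apply/allP => _ /mapP[i s'i ->]; have := s'_supp i s'i.
    rewrite mnmDE addn_gt0 => /orP[/m_on|].
      by rewrite inE ltnNge (allP le_s'c) ?map_f.
    rewrite mon_of_seq_gt0 => si; apply/hasP; exists (val i); first exact: map_f.
    by rewrite leqnn /= -[X in (X < _)%N]addn0 ltn_add2l.
  rewrite !size_map => le_sz eq_sz; split=> // /eq_sz[le_sum eq_sum].
  by split=> // /eq_sum /(inj_map val_inj).
have sz_s : size s = size b by rewrite -(admissible_size adm_s) size_map.
(* A generator of I_(m+1) is longer than s; one in L has no larger sum, which would force s' = s. *)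
case: div_m => [[s' adm_s' le_s'] | [s' Ls' le_s']].
  have [sort_s' le_s'b] := andP adm_s'.
  have [||] := dominated s' _ _ le_s' => //.
    by apply: all2_leq_bound le_s'b; rewrite all_rcons leqnn.
  by rewrite -(size_map val s') (admissible_size adm_s') size_rcons sz_s ltnn.
have [adm_s' ne_s' le_sum] := L_adm s' Ls'.
have [sort_s' le_s'b] := andP adm_s'.
have [_ eq_sz] := dominated s' (all2_leq_bound le_bc le_s'b) sort_s' le_s'.
have [|ge_sum eq_sum] := eq_sz.
  by rewrite -(size_map val s') (admissible_size adm_s') sz_s.
case/eqP: ne_s'; apply: eq_sum; apply/eqP.
by rewrite eqn_leq le_sum.
Qed.

Lemma borel_clean (K : fieldType) b c (u : seq 'I_n) : map val u = b ->
  (c < n)%N -> sorted (spread t) (rcons b c) ->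
  clean_filtration (n - c.+1 + size b * t)
    (@mon_span K n (borel_mon (rcons b c))) (@mon_span K n (borel_mon b)).
Proof.
move=> def_b lt_cn sort_bc.
have := sort_bc; rewrite sorted_spread_rcons => /andP[bc sort_b].
pose rank s := sumn (map val s).
pose le_rank s s' := (rank s <= rank s')%N.
pose L : seq (seq 'I_n) := sort le_rank
  (map (@tval (size b) 'I_n) [seq s <- enum {: (size b).-tuple 'I_n} |
     admissible t b (map val (tval s))]).
have le_rank_trans : transitive le_rank by move=> ? ? ?; apply: leq_trans.
have memL s : (s \in L) = admissible t b (map val s).
  rewrite mem_sort; apply/mapP/idP => [[s' + ->] | adm_s].
    by rewrite mem_filter => /andP[].
  have sz_s : size s == size b by rewrite -(admissible_size adm_s) size_map.
  by exists (Tuple sz_s) => //; rewrite mem_filter adm_s mem_enum.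
have uniqL : uniq L.
  rewrite sort_uniq map_inj_uniq; last exact: val_inj.
  by rewrite filter_uniq // enum_uniq.
have sortL : pairwise le_rank L.
  rewrite -sorted_pairwise //; apply: sort_sorted => s s'; exact: leq_total.
(* The sequence u itself witnesses that L is nonempty. *)
have adm_u : admissible t b (map val u).
  by rewrite /admissible def_b sort_b; elim: (b) => //= x b' ->; rewrite leqnn.
apply: (@clean_filtration_eq K n _ (@mon_span K n (borel_mon (rcons b c))) _
  (@mon_span K n (fun m => borel_mon (rcons b c) m \/
     exists2 s, s \in L & (mon_of_seq s <= m)%MM))) => // [p|].
  split=> Gp m /Gp => [[/borel_mon_rcons // | [s]]|[s adm_s le_s]].
    by rewrite memL; exists s.
  by right; exists s; rewrite ?memL.
apply: (@clean_monomial_list K n _ L (@mon_of_seq n)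
  (fun s => free_vars n t c (map val s))).
- exact: borel_mon_up.
- by apply/eqP => L0; rewrite -memL L0 in adm_u.
- move=> s; rewrite memL => adm_s; have [sort_s le_sb] := andP adm_s.
  rewrite card_free_vars // ?(admissible_size adm_s) //.
  apply: (@sub_all _ (spread t ^~ c)); first by move=> x; apply: leqW.
  by apply: (all2_leq_all _ bc le_sb) => x y; rewrite /spread; lia.
move=> L1 s L2 defL m.
have Ls : s \in L by rewrite defL mem_cat mem_head orbT.
have := sortL; rewrite defL pairwise_cat => /and3P[/allrelP L12 _ /=/andP[sL2 _]].
have := uniqL; rewrite defL cat_uniq => /and3P[_ /hasPn nL2 _].
apply: borel_colon => //; first by rewrite -memL.
  move=> s' L1s'; split; first by rewrite -memL defL mem_cat L1s'.
    by apply: contraTneq L1s' => ->; apply: nL2; apply: mem_head.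
  by apply: L12 => //; apply: mem_head.
move=> s' adm_s' lt_s'.
have: s' \in L by rewrite memL.
rewrite defL mem_cat inE => /or3P[// | /eqP eq_s' | L2s'].
  by rewrite eq_s' ltnn in lt_s'.
by have := allP sL2 s' L2s'; rewrite /le_rank /rank leqNgt lt_s'.
Qed.

End BorelMonomials.

(** * Identification of B_t(u) and conclusion *)

Section BorelIdeal.
Variables (K : fieldType) (n t : nat).
Hypothesis t_gt0 : (0 < t)%N.
Local Notation S := {mpoly K[n]}.
Implicit Types (I J : S -> Prop) (s : seq 'I_n) (m w : 'X_{1..n}) (b : seq nat).

Lemma t_spreadP m : t_spread t m <->
  exists2 s, sorted (spread t) (map val s) & m = mon_of_seq s.
Proof.
by split=> -[s sort_s ->]; exists s;
  rewrite // ?sorted_spread_map // -sorted_spread_map.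
Qed.

Lemma t_spread_dvd m m' : t_spread t m' -> (m <= m')%MM -> t_spread t m.
Proof.
case/t_spreadP=> s sort_s -> /mnm_lepP le_ms; apply/t_spreadP.
exists [seq i <- s | (0 < m i)%N].
  apply: (subseq_sorted (@spread_trans t)) sort_s.
  exact/map_subseq/filter_subseq.
apply/mnmP => i; have := le_ms i; rewrite !mon_of_seqE.
rewrite !count_uniq_mem ?filter_uniq ?(sorted_spread_uniq t_gt0 sort_s) //.
by rewrite mem_filter; case: (posnP (m i)) => [-> //|] /=; case: (i \in s); lia.
Qed.

Lemma mon_generators_ideal I G : mon_generators I G -> is_ideal I.
Proof.
move=> genI; have [G0 GD GM] : is_ideal (@mon_ideal K n G) by apply: ideal_gen_ideal.
split=> [|f g /genI If /genI Ig | f g /genI Ig]; apply/genI => //.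
  exact: GD.
exact: GM.
Qed.

(* The exchange condition, required on minimal generators only, holds for all *)
(* t-spread monomials of the ideal.                                           *)
Lemma strongly_stable_exchange I w (i j : 'I_n) :
  t_spread_strongly_stable t I -> I 'X_[w] -> (i < j)%N ->
  t_spread t (w - U_(j) + U_(i))%MM -> I 'X_[(w - U_(j) + U_(i))%MM].
Proof.
case=> _ [G [genG _] stabG] Iw lt_ij spr.
have idI := mon_generators_ideal genG.
have up m m' : I 'X_[m] -> (m <= m')%MM -> I 'X_[m'].
  by move=> Im /lepmP->; rewrite mpolyXD; apply: (idealMr _ idI).
have [w' Gw' /mnm_lepP le_w'] : exists2 w', G w' & (w' <= w)%MM.
  by move/genG: Iw => /mon_idealP/mon_spanX.
have Iw' : I 'X_[w'] by apply/genG/mon_idealP/mon_spanX; exists w';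
  rewrite ?lepm_refl.
(* If x_j does not divide w', then w' already divides w / x_j. *)
case: (posnP (w' j)) => [w'j0 | w'j].
  apply: up Iw' _; apply/mnm_lepP => k; rewrite mnmDE mnmBE !mnm1E.
  by have := le_w' k; case: (j =P k) => [<-|]; lia.
have le_ww : (w' - U_(j) + U_(i) <= w - U_(j) + U_(i))%MM.
  by apply/mnm_lepP => k; rewrite !mnmDE !mnmBE; have := le_w' k; lia.
apply: (up _ _ _ le_ww); apply: stabG => //; exact: t_spread_dvd le_ww.
Qed.

Lemma mon_of_seq_exchange s (i j : 'I_n) : j \in s ->
  (mon_of_seq s - U_(j) + U_(i))%MM = mon_of_seq (i :: rem j s).
Proof.
move=> sj; rewrite (proj2 (mon_of_seq_perm _ _) (perm_to_rem sj)).
by rewrite !mon_of_seq_cons; apply/mnmP => k; rewrite !(mnmDE, mnmBE); lia.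
Qed.

Lemma borel_strongly_stable b : sorted (spread t) b ->
  t_spread_strongly_stable t (@mon_span K n (borel_mon t b)).
Proof.
move=> sort_b.
pose G w := exists2 s, admissible t b (map val s) & w = mon_of_seq s.
have genG : mon_generators (@mon_span K n (borel_mon t b)) G.
  move=> f; rewrite mon_idealP; split=> Gf m /Gf.
    by case=> s adm_s le_s; exists (mon_of_seq s) => //; exists s.
  by case=> w [s adm_s ->]; exists s.
split; first exists G => //.
  by move=> w [s /andP[sort_s _] ->]; apply/t_spreadP; exists s.
exists G.
  (* All elements of G have the same degree, so an element of G' dividing w equals w. *)
  split=> // G' sG'G genG' w Gw.
  have : mon_ideal G' ('X_[w] : S).
    by apply/genG'/genG/mon_idealP/mon_spanX; exists w; rewrite ?lepm_refl.
  move/mon_idealP/mon_spanX => [w' G'w' le_w'].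
  rewrite -(lep_mdeg_eq le_w') //; have [s' adm_s' ->] := sG'G _ G'w'.
  case: Gw => s adm_s ->; rewrite !mdeg_mon_of_seq.
  by rewrite -!(size_map val) (admissible_size adm_s) (admissible_size adm_s').
move=> w i j [s adm_s ->]; rewrite mon_of_seq_gt0 => sj lt_ij.
rewrite mon_of_seq_exchange // => /t_spreadP[s' sort_s' /mon_of_seq_perm perm_s'].
apply/mon_spanX; exists s'; last first.
  by rewrite (proj2 (mon_of_seq_perm _ _) perm_s') lepm_refl.
apply: (admissible_lower (i := i) (j := j) (r := map val (rem j s))) adm_s _ _ _ _ => //.
- exact: sorted_spread_leq sort_b.
- exact: ltnW.
- by rewrite -map_cons; apply/perm_map/perm_to_rem.
by rewrite -map_cons perm_sym; apply: perm_map.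
Qed.

(* Replaces the indices of u by those of s one at a time, from the left; all  *)
(* intermediate monomials are t-spread.                                       *)
Lemma strongly_stable_lower I p s u :
  t_spread_strongly_stable t I ->
  sorted (spread t) (map val (p ++ u)) -> sorted (spread t) (map val (p ++ s)) ->
  all2 leq (map val s) (map val u) ->
  I 'X_[mon_of_seq (p ++ u)] -> I 'X_[mon_of_seq (p ++ s)].
Proof.
move=> stabI; elim: u s p => [|j u IH] [|i s] p //= sort_u sort_s /andP[le_ij le_su] Iu.
(* The distance from p to i comes from [sort_s]; the distance from i to u comes from [sort_u], as i
   is at most j. *)
have sort_iu : sorted (spread t) (map val (p ++ i :: u)).
  move: sort_u sort_s; rewrite !map_cat /=.
  have catE a (l1 l2 : seq nat) : sorted (spread t) (l1 ++ a :: l2) =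
      [&& all (spread t ^~ a) l1, sorted (spread t) l1, all (spread t a) l2
        & sorted (spread t) l2].
    rewrite -cat_rcons; elim: l1 => [|x l1 IHl];
      first by rewrite /= (path_sortedE (@spread_trans t)).
    rewrite rcons_cons cat_cons !sorted_spread_cons all_cat all_rcons IHl /=.
    apply/idP/idP.
      by case/and4P=> /andP[/andP[-> ->] _] -> -> /andP[-> ->].
    case/and4P=> /andP[xa ->] /andP[xl1 ->] al2 ->; rewrite xa xl1 al2 /= andbT.
    by apply: sub_all al2 => y; move: xa; rewrite /spread; lia.
  rewrite !catE => /and4P[_ -> ju ->] /and4P[-> _ _ _] /=; rewrite andbT.
  by apply: sub_all ju => y; rewrite /spread; lia.
rewrite -cat_rcons; apply: IH => //; rewrite ?cat_rcons //.
case: (ltngtP i j) le_ij => // [lt_ij _ | /val_inj-> //].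
have exch : (mon_of_seq (p ++ j :: u) - U_(j) + U_(i))%MM = mon_of_seq (p ++ i :: u).
  rewrite mon_of_seq_exchange ?mem_cat ?mem_head ?orbT //.
  apply/mon_of_seq_perm; rewrite perm_sym -cat1s perm_catCA /= perm_cons.
  have := perm_to_rem (_ : j \in p ++ j :: u).
  rewrite mem_cat mem_head orbT => /(_ isT).
  by rewrite -cat1s perm_catCA /= perm_cons.
rewrite -exch; apply: strongly_stable_exchange => //.
by rewrite exch; apply/t_spreadP; exists (p ++ i :: u).
Qed.

(** Minimality of I gives one inclusion, [strongly_stable_lower] with empty prefix the other. *)
Lemma principal_BorelE (u : seq 'I_n) I : sorted (spread t) (map val u) ->
  is_t_spread_principal_Borel t (mon_of_seq u) I ->
  forall f, I f <-> mon_span (borel_mon t (map val u)) f.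
Proof.
move=> sort_u [stabI Iu minI] f; split.
  apply: minI; first exact: borel_strongly_stable.
  apply/mon_spanX; exists u; last exact: lepm_refl.
  by rewrite /admissible sort_u; elim: (map val u) => //= x s ->; rewrite leqnn.
have [[G _ genG] _] := stabI; have idI := mon_generators_ideal genG.
move=> uf; apply: (ideal_mpoly idI) => m /uf[s /andP[sort_s le_su] /lepmP->].
rewrite mpolyXD; apply: (idealMr _ idI).
exact: (@strongly_stable_lower I [::] s u).
Qed.

Lemma t_spread_sorted (u : seq 'I_n) :
  sorted (fun i j : 'I_n => (i < j)%N) u -> t_spread t (mon_of_seq u) ->
  sorted (spread t) (map val u).
Proof.
move=> sort_u /t_spreadP[s sort_s /mon_of_seq_perm perm_u].
suff -> : u = s by [].
apply: (inj_map val_inj); apply: (irr_sorted_eq ltn_trans ltnn).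
- by rewrite sorted_map.
- exact: (sorted_spread_ltn t_gt0 sort_s).
- exact/perm_mem/perm_map.
Qed.

Lemma borel_sequentially_CohenMacaulay (u : seq 'I_n) :
  sorted (spread t) (map val u) ->
  sequentially_CohenMacaulay_ideal (@mon_span K n (borel_mon t (map val u))).
Proof.
move=> sort_u; set d := size u.
pose b k := take k (map val u); pose c k := nth 0%N (map val u) k.
(* An ascending chain: E i is I_(d-i), so it ends with I_0 = S. *)
pose E i := @mon_span K n (borel_mon t (b (d - i)%N)).
pose dimE i := (n - (c (d - i.+1)).+1 + (d - i.+1) * t)%N.
have lt_cn k : (k < d)%N -> (c k < n)%N.
  case: u @d {b E dimE sort_u} @c => // i0 u d c lt_k.
  by rewrite /c (nth_map i0) // ltn_ord.
have bS k : (k < d)%N -> b k.+1 = rcons (b k) (c k).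
  by move=> lt_k; rewrite /b (take_nth 0%N) ?size_map.
have sort_bS k : sorted (spread t) (b k) by apply: take_sorted.
have : sequentially_CohenMacaulay (E 0%N) (E d).
  apply: (sequentially_CohenMacaulay_clean (dimE := dimE)) => i.
  - by move=> _; apply: mon_span_graded; apply: borel_mon_up.
  - move=> lt_i; rewrite /E /dimE -(subnSK lt_i).
    set k := (d - i.+1)%N; have lt_k : (k < d)%N by rewrite /k; lia.
    rewrite bS //; have {2}-> : k = size (b k).
      by rewrite size_take size_map lt_k.
    apply: (@borel_clean n t t_gt0 K _ _ (take k u)); first by rewrite map_take.
      exact: lt_cn.
    by rewrite -bS.
  move=> lt_i; rewrite /dimE; set k := (d - i.+2)%N.
  have -> : (d - i.+1)%N = k.+1 by rewrite /k; lia.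
  have lt_k : (k.+1 < d)%N by rewrite /k; lia.
  (* The dimensions differ by c_(k+1) - c_k - t, which is nonnegative because u is t-spread. *)
  have := lt_cn _ lt_k; suff : spread t (c k) (c k.+1) by rewrite /spread; lia.
  have := sort_bS k.+2; rewrite bS // (bS k) 1?ltnW //.
  by rewrite sorted_spread_rcons all_rcons => /andP[/andP[]].
case=> r [F [dimF [[F0 Fr] gradF incF CMF ltF]]].
exists r, F, dimF; split=> //; split=> f.
  by rewrite F0 /E /b subn0 take_oversize ?size_map.
rewrite Fr; split=> // _ m _; rewrite /b subnn take0; exact: borel_mon_nil.
Qed.

End BorelIdeal.

(* u = x_{i_1} ... x_{i_d} with [:: i_1; ...; i_d] = rcons s l and i_d = n. *)
Theorem theorem1p2 (K : fieldType) (n t : nat) (s : seq 'I_n) (l : 'I_n)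
    (I : {mpoly K[n]} -> Prop) :
  (0 < t)%N ->
  sorted (fun i j : 'I_n => (i < j)%N) (rcons s l) ->
  t_spread t (mon_of_seq (rcons s l)) ->
  l.+1 = n ->
  is_t_spread_principal_Borel t (mon_of_seq (rcons s l)) I ->
  sequentially_CohenMacaulay_ideal I.
Proof.
move=> t_gt0 sort_u spread_u _ borelI.
have sort_spread := t_spread_sorted t_gt0 sort_u spread_u.
have eqI := principal_BorelE t_gt0 sort_spread borelI.
have [r [F [dimF [[F0 Fr] gradF incF CMF ltF]]]] :=
  borel_sequentially_CohenMacaulay K t_gt0 sort_spread.
exists r, F, dimF; split=> //; split=> // f.
by rewrite F0 eqI.
Qed.
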